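(* The functions $\mathrm{cr},\ \mathrm{cr}^{(2)},\ \mathrm{cr}^{(4)},\dots$ (the even-order coefficients $\mathrm{cr}^{(2m)}$, $m\ge0$) on the set of ordered quadruples of pairwise distinct points of $\mathbb P^1(\mathbb Q)$, which are genuine $\mathrm{PGL}(2,\mathbb Z)$-invariants, are algebraically independent over $\mathbb C$.
   Context: $\mathrm{PGL}(2,\mathbb Z)=\mathrm{GL}(2,\mathbb Z)/\{\pm1\}$ acts on $\mathbb P^1(\mathbb Q)=\mathbb Q\cup\{\infty\}$ by fractional-linear transformations and on quadruples simultaneously. **$q$-rationals.** $[\,\cdot\,]_q:\mathbb P^1(\mathbb Q)\to\mathbb P^1(\mathbb Q(q))$ is the unique map with $[0]_q=0$, $[x+1]_q=q[x]_q+1$ and $[-1/x]_q=-1/(q[x]_q)$ for all $x$ (usual conventions for $\infty$; in particular $[\infty]_q=\infty$). For finite $x$, $[x]_q$ is a rational function of $q$, regular at $q=1$ with $[x]_1=x$. **Cross-ratios.** For pairwise distinct points of $\mathbb P^1(\mathbb K)$ with nonzero lifts $X_i\in\mathbb K^2$ and $\Delta_{ij}=\det(X_i,X_j)$, $\mathrm{cr}(x_1,x_2;x_3,x_4)=\frac{\Delta_{13}\Delta_{24}}{\Delta_{14}\Delta_{23}}$ (equal to $\frac{(x_1-x_3)(x_2-x_4)}{(x_1-x_4)(x_2-x_3)}$ in finite affine coordinates). For pairwise distinct $x_i\in\mathbb P^1(\mathbb Q)$, $\mathrm{cr}_q(x_1,x_2;x_3,x_4)=\mathrm{cr}([x_1]_q,[x_2]_q;[x_3]_q,[x_4]_q)\in\mathbb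 Q(q)$. **Taylor coefficients.** The coefficients $\mathrm{cr}^{(n)}$ are the functions of the quadruple defined by the expansion at $h=0$, with $q=e^h$: $\mathrm{cr}_{e^h}=\sum_{n\ge0}\mathrm{cr}^{(n)}h^n/n!$; $\mathrm{cr}^{(0)}=\mathrm{cr}$. **Algebraic independence.** Functions $J_0,\dots,J_{N-1}$ on a set are algebraically independent over $\mathbb C$ if there is no nonzero polynomial $P\in\mathbb C[T_0,\dots,T_{N-1}]$ such that $P(J_0,\dots,J_{N-1})$ vanishes identically on the set. An infinite sequence is algebraically independent if its first $N$ terms are, for every $N$. *)

(* Defs.v *)
From HB Require Import structures.
From mathcomp Require Import all_boot all_order all_algebra.
From mathcomp Require Import generic_quotient fraction.
From mathcomp Require Import all_classical all_reals all_analysis.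
From mathcomp Require Import complex ring zify.
(* The notations of mpoly clash with those of MathComp-Analysis. *)
From mathcomp.multinomials Require Import -(notations) mpoly.

Set Implicit Arguments.
Unset Strict Implicit.
Unset Printing Implicit Defensive.

Import Order.TTheory GRing.Theory Num.Theory.
Import numFieldNormedType.Exports.

Local Open Scope ring_scope.

(* [None] is the point at infinity. *)
Definition P1 (K : Type) : Type := option K.

Section ProjectiveLine.
Variable K : fieldType.
Implicit Types (x : P1 K) (X Y : 'cV[K]_2).

Definition lift_P1 x : 'cV[K]_2 :=
  \col_i (if x is Some a then [:: a; 1] else [:: 1; 0])`_i.

(* The point with homogeneous coordinates [X] (meant for nonzero [X]). *)
Definition P1_of X : P1 K :=
  if X 1 0 == 0 then None else Some (X 0 0 / X 1 0).

Definition moebius (M : 'M[K]_2) x : P1 K := P1_of (M *m lift_P1 x).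

(* Indices 0, 1, 2, 3 stand for the points x1, x2, x3, x4. *)
Definition crlift (X : 'I_4 -> 'cV[K]_2) : K :=
  let Delta i j := \det (row_mx (X i) (X j)) in
  (Delta 0 2 * Delta 1 3) / (Delta 0 3 * Delta 1 2).

Definition cr (x : 4.-tuple (P1 K)) : K := crlift (fun i => lift_P1 (tnth x i)).

Lemma det_cols X Y : \det (row_mx X Y) = X 0 0 * Y 1 0 - Y 0 0 * X 1 0.
Proof.
have r0 i (j : 'I_2) : j = 0%N :> nat -> row_mx X Y i j = X i 0.
  by move=> hj; rewrite -[RHS](row_mxEl X Y); congr fun_of_matrix; apply: val_inj.
have r1 i (j : 'I_2) : j = 1%N :> nat -> row_mx X Y i j = Y i 0.
  by move=> hj; rewrite -[RHS](row_mxEr X Y); congr fun_of_matrix; apply: val_inj.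
rewrite (expand_det_row _ (0 : 'I_2)) !big_ord_recl big_ord0 addr0 /cofactor.
rewrite (r0 _ (0 : 'I_2)) // (r1 _ (lift _ _)) // !det_mx11.
have c j : row' (0 : 'I_2) (col' j (row_mx X Y)) 0 0 =
           row_mx X Y (lift (0 : 'I_2) 0) (lift j 0) by rewrite 2!mxE.
rewrite !c (r1 _ (lift _ _)) // r0 //.
have -> // : lift (0 : 'I_2) (0 : 'I_1) = 1 by apply: val_inj.
by rewrite /= expr0 expr1 mul1r mulN1r mulrN.
Qed.

Lemma lift_P1_neq0 x : lift_P1 x != 0.
Proof.
apply/eqP => /matrixP h; case: x h => [a|] h.
  by have := h 1 0; rewrite !mxE /= => /eqP; rewrite oner_eq0.
by have := h 0 0; rewrite !mxE /= => /eqP; rewrite oner_eq0.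
Qed.

Lemma colP2 X Y : X 0 0 = Y 0 0 -> X 1 0 = Y 1 0 -> X = Y.
Proof.
move=> e0 e1; apply/colP => i.
case: i => [[|[|//]] hi].
  by have -> : Ordinal hi = 0 by apply: val_inj.
by have -> : Ordinal hi = 1 by apply: val_inj.
Qed.

Lemma lift_P1_of X : X != 0 ->
  exists2 c : K, c != 0 & X = c *: lift_P1 (P1_of X).
Proof.
move=> X0; rewrite /P1_of; case: (X 1 0 =P 0) => [X1|/eqP X1].
  exists (X 0 0).
    by apply: contra X0 => /eqP h; apply/eqP; apply: colP2; rewrite mxE.
  by apply: colP2; rewrite !mxE /= ?mulr1 // X1 mulr0.
exists (X 1 0) => //; apply: colP2; rewrite !mxE /= ?mulr1 //.
by rewrite mulrC divfK.
Qed.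

Lemma lift_P1K x : P1_of (lift_P1 x) = x.
Proof.
by case: x => [a|]; rewrite /P1_of !mxE /= ?eqxx // oner_eq0 divr1.
Qed.

(* The cross-ratio may be computed with arbitrary nonzero lifts. *)
Lemma cr_lift (X : 'I_4 -> 'cV[K]_2) (x : 4.-tuple (P1 K)) :
  (forall i, X i != 0) -> (forall i, P1_of (X i) = tnth x i) ->
  cr x = crlift X.
Proof.
move=> X0 Xx; rewrite /cr.
have hc i : exists c : K, c != 0 /\ X i = c *: lift_P1 (tnth x i).
  by have [c c0 e] := lift_P1_of (X0 i); exists c; rewrite -Xx.
have [c0 [n0 e0]] := hc 0; have [c1 [n1 e1]] := hc 1.
have [c2 [n2 e2]] := hc 2; have [c3 [n3 e3]] := hc 3.
rewrite /crlift !det_cols e0 e1 e2 e3 !(mxE, det_cols).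
have D0 : c0 * c1 * c2 * c3 != 0 by rewrite !mulf_neq0.
set p := (X in _ = X / _); set d := (X in _ = _ / X).
set p' := (X in X / _ = _); set d' := (X in _ / X = _).
have -> : p = (c0 * c1 * c2 * c3) * p' by rewrite /p /p'; ring.
have -> : d = (c0 * c1 * c2 * c3) * d' by rewrite /d /d'; ring.
by rewrite -[LHS]mul1r -(divff D0) mulf_div.
Qed.

End ProjectiveLine.

Section QRationals.
Variables (K : fieldType) (q : K).

(* y |-> q y + 1, which is y |-> y + 1 when q = 1 *)
Definition qshift (y : P1 K) : P1 K :=
  if y is Some b then Some (q * b + 1) else None.

(* y |-> -1 / (q y), which is y |-> -1 / y when q = 1 *)
Definition qneginv (y : P1 K) : P1 K :=
  if y is Some b then if b == 0 then None else Some (- 1 / (q * b)) else Some 0.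
End QRationals.

Definition is_qrat (K : fieldType) (q : K) (f : P1 rat -> P1 K) : Prop :=
  [/\ f (Some 0) = Some 0,
      forall x, f (qshift 1 x) = qshift q (f x) &
      forall x, f (qneginv 1 x) = qneginv q (f x)].

Lemma modz_absz a (b : nat) : (0 < b)%N -> (`|(a %% b)%Z|%N < b)%N.
Proof.
move=> b0; have h1 : (0 <= (a %% b)%Z) by apply: modz_ge0; lia.
have h2 : ((a %% b)%Z < b%:Z) by apply: ltz_pmod; lia.
lia.
Qed.

Lemma rat_coprime (x : rat) : exists (a : int) (b : nat),
  [/\ (0 < b)%N, coprime `|a| b & x = a%:~R / b%:R].
Proof.
exists (numq x), `|denq x|%N; split; first by have := denq_gt0 x; lia.
  exact: coprime_num_den.
by rewrite -[LHS]divq_num_den; congr (_ / _); have := denq_gt0 x; case: (denq x).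
Qed.

(* x |-> x + 1, its inverse and x |-> -1 / x act transitively on P1(Q). *)
Lemma P1Q_ind (P : P1 rat -> Prop) :
  P (Some 0) -> (forall x, P x -> P (qshift 1 x)) ->
  (forall x, P (qshift 1 x) -> P x) -> (forall x, P x -> P (qneginv 1 x)) ->
  forall x, P x.
Proof.
move=> P0 PT PT' PS.
have Pinf : P None by exact: (PS (Some 0)).
have PZ (k : int) x : P (Some x) -> P (Some (x + k%:~R)).
  move=> Px; elim: k => [|n IH|n IH]; first by rewrite addr0.
    by rewrite -addn1 PoszD intrD addrA -[x + _]mul1r; apply: (PT (Some _)).
  apply: PT'; rewrite /= mul1r; suff -> : x + (- n.+1%:Z)%:~R + 1 = x + (- n%:Z)%:~R by [].
  by rewrite -addn1 PoszD !rmorphN rmorphD /=; ring.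
suff PQ (b : nat) (a : int) : (0 < b)%N -> P (Some (a%:~R / b%:R)).
  by case=> [x|//]; have [a [b [b0 _ ->]]] := rat_coprime x; exact: PQ.
have [n le_n] := ubnP b; elim: n b le_n a => // n IH b le_n a b0.
have bn0 : b%:R != 0 :> rat by rewrite pnatr_eq0; lia.
have -> : a%:~R / b%:R = (a %% b)%Z%:~R / b%:R + (a %/ b)%Z%:~R :> rat.
  by rewrite {1}(divz_eq a b) intrD intrM; field.
apply: PZ; have := modz_absz a b0.
have : 0 <= (a %% b)%Z by apply: modz_ge0; lia.
case: (a %% b)%Z => // -[_ _|r _ rb]; first by rewrite mul0r.
have := PS _ (IH r.+1 _ (- b%:Z) _); rewrite /= mul1r.
have rn0 : r.+1%:R != 0 :> rat by rewrite pnatr_eq0.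
rewrite mulf_eq0 invr_eq0 (negPf rn0) rmorphN oppr_eq0 (negPf bn0) /=.
have -> : -1 / (- b%:~R / r.+1%:R) = r.+1%:~R / b%:R :> rat.
  rewrite -!pmulrn; move: bn0 rn0; move: (b%:R : rat) (r.+1%:R : rat) => u v u0 v0.
  by field; rewrite u0 v0.
by apply; lia.
Qed.

Section Existence.
Variables (K : fieldType) (q : K).
Hypothesis q0 : q != 0.

Let T := @qshift K q.
Let S := @qneginv K q.
Let T' (y : P1 K) : P1 K := if y is Some b then Some ((b - 1) / q) else None.

Lemma qshiftK : cancel T T'.
Proof. by case=> [b|] //=; rewrite addrK mulrC mulKf. Qed.

Lemma qshiftVK : cancel T' T.
Proof. by case=> [b|] //=; rewrite mulrC divfK // subrK. Qed.

Lemma qneginvK : involutive S.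
Proof.
case=> [b|] /=; last by rewrite eqxx.
have [->//|b0] /= := eqVneq b 0.
have n0 : -1 / (q * b) != 0 by rewrite mulf_neq0 ?invr_eq0 ?mulf_neq0 ?oppr_eq0 ?oner_eq0.
rewrite (negPf n0); congr Some; rewrite mulrA; field.
by rewrite q0 b0 oppr_eq0 oner_eq0.
Qed.

Lemma qST3 y : S (T (S (T (S (T y))))) = y.
Proof.
suff h z : S (T (S (T z))) = T' (S z) by rewrite h qneginvK qshiftK.
case: z => [b|] /=; last first.
  rewrite mulr0 add0r oner_eq0 /= sub0r mulr1.
  by congr Some; field.
have [->|b0] := eqVneq b 0.
  rewrite mulr0 add0r oner_eq0 /= mulr1 mulrA mulrN1.
  have -> : - q / q + 1 = 0 by rewrite mulNr divff // addNr.
  by rewrite eqxx.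
have [e|e0] /= := eqVneq (q * b + 1) 0.
  congr Some; have -> : q * b = - 1 by apply/eqP; rewrite -addr_eq0 e.
  by rewrite divff ?oppr_eq0 ?oner_eq0 // subrr mul0r.
have e : q * (-1 / (q * (q * b + 1))) + 1 = q * b / (q * b + 1).
  by field; rewrite e0 q0.
rewrite e !mulf_eq0 (negPf q0) (negPf b0) invr_eq0 (negPf e0) /=.
by congr Some; field; rewrite q0 b0 e0.
Qed.

Definition qshiftz (k : int) : P1 K -> P1 K :=
  match k with Posz n => iter n T | Negz n => iter n.+1 T' end.

Lemma qshiftzS k y : qshiftz (k + 1) y = T (qshiftz k y).
Proof.
case: k => [n|[|n]]; first by rewrite -PoszD addn1.
  by rewrite /= qshiftVK.
have -> : Negz n.+1 + 1 = Negz n by rewrite !NegzE; lia.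
by rewrite [in RHS]/= qshiftVK.
Qed.

(* Negative continued fraction expansion of a / b, with fuel n >= b. *)
Fixpoint qcfrac (n : nat) (a : int) (b : nat) : P1 K :=
  if n is m.+1 then
    qshiftz (a %/ b)%Z (if (a %% b)%Z == 0 then Some 0
                   else S (qcfrac m (- b%:Z) `|(a %% b)%Z|%N))
  else Some 0.

Lemma qcfrac_fuel n m a b : (0 < b)%N -> (b <= n)%N -> (b <= m)%N -> qcfrac n a b = qcfrac m a b.
Proof.
elim: n m a b => [|n IH] [|m] a b b0 bn bm //=; try lia.
case: eqP => // r0; congr (qshiftz _ (S _)); have := modz_absz a b0 => ?.
apply: IH; lia.
Qed.

Let g (a : int) (b : nat) := qcfrac b a b.

Lemma gE a b : (0 < b)%N ->
  g a b = qshiftz (a %/ b)%Z (if (a %% b)%Z == 0 then Some 0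
                   else S (g (- b%:Z) `|(a %% b)%Z|%N)).
Proof.
move=> b0; rewrite /g; case: b b0 => // b b0; rewrite {1}/qcfrac -/qcfrac.
case: eqP => // r0; congr (qshiftz _ (S _)).
by apply: qcfrac_fuel; have := modz_absz a b0; lia.
Qed.

Lemma gT a b : (0 < b)%N -> g (a + b%:Z) b = T (g a b).
Proof.
move=> b0; rewrite [LHS]gE // [in RHS]gE // -qshiftzS modzDr divzDr ?dvdzz //.
by rewrite divzz; have -> : (b%:Z != 0) by lia.
Qed.

Lemma gSlt a b : (0 < a)%N -> (a < b)%N -> g (- b%:Z) a = S (g a b).
Proof.
move=> a0 ab; rewrite [g a b]gE; last lia.
rewrite divz_small ?modz_small; [|lia|lia].
have -> /= : (a%:Z == 0) = false by lia.
by rewrite qneginvK.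
Qed.

Lemma gS a b : (0 < a)%N -> (0 < b)%N -> g (- b%:Z) a = S (g a b).
Proof.
have [n le_n] := ubnP (a + b)%N; elim: n a b le_n => // n IH a b le_n a0 b0.
have [ab|ba|->] := ltngtP a b; first exact: gSlt.
  have e1 : g (- b%:Z) a = T' (g (a - b)%N a).
    by rewrite -[LHS]qshiftK -gT // -(subzn (ltnW ba)) addrC.
  have e2 : g (a - b)%N a = S (g (- a%:Z) (a - b)%N).
    by rewrite gSlt ?qneginvK //; lia.
  have e3 : g (- a%:Z) (a - b)%N = T' (g (- b%:Z) (a - b)%N).
    by rewrite -[LHS]qshiftK -gT; [congr (T' (g _ _)); lia | lia].
  have e4 : g (- b%:Z) (a - b)%N = S (g (a - b)%N b).
    by apply: IH; lia.
  have e5 : g (a - b)%N b = T' (g a b).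
    by rewrite -[LHS]qshiftK -gT //; congr (T' (g _ _)); lia.
  rewrite e1 e2 e3 e4 e5 -[LHS]qST3.
  by rewrite !(qshiftVK, qneginvK).
have bn0 : b%:Z != 0 by lia.
have d1 : (b %/ b)%Z = 1 by rewrite divzz bn0.
have m1 : (b %% b)%Z = 0 by exact: modzz.
have d2 : (- b%:Z %/ b)%Z = -1 by rewrite -[X in (X %/ _)%Z]mulN1r mulzK.
have m2 : (- b%:Z %% b)%Z = 0 by rewrite -[X in (X %% _)%Z]mulN1r modzMl.
rewrite (gE _ b0) (gE b b0) d1 m1 d2 m2 /= mulr0 !add0r oner_eq0 mulr1.
by [].
Qed.

Definition qrat_of (x : P1 rat) : P1 K :=
  if x is Some a then g (numq a) `|denq a|%N else None.

Lemma qrat_of_num (a : int) (b : nat) : (0 < b)%N -> coprime `|a| b ->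
  qrat_of (Some (a%:~R / b%:R)) = g a b.
Proof.
move=> b0 ab; rewrite /qrat_of pmulrn coprimeq_num // coprimeq_den //.
have -> : (b%:Z == 0) = false by lia.
by rewrite gtr0_sg ?mul1r.
Qed.

Lemma qrat_ofP : is_qrat q qrat_of.
Proof.
split.
- have -> : 0 = 0%:~R / 1%:R :> rat by rewrite mul0r.
  by rewrite qrat_of_num.
- case=> [x|//]; rewrite [qshift 1 _]/= mul1r.
  have [a [b [b0 ab ->]]] := rat_coprime x.
  have -> : a%:~R / b%:R + 1 = (a + b%:Z)%:~R / b%:R :> rat.
    by rewrite intrD; field; rewrite pnatr_eq0; lia.
  rewrite !qrat_of_num ?gT //.
  move: ab; rewrite /coprime; have -> : gcdn `|a + b%:Z| b = `|gcdz (a + b%:Z) b|%N by [].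
  by rewrite gcdzC gcdzDr gcdzC.
case=> [x|] //.
suff pos y : 0 < y ->
    qrat_of (qneginv 1 (Some y)) = qneginv q (qrat_of (Some y)).
  have [x0|x0|<-] := ltgtP 0 x; first exact: pos.
  - have : 0 < - x^-1 by rewrite oppr_gt0 invr_lt0.
    move=> /pos; have -> : qneginv 1 (Some (- x^-1)) = Some x.
      rewrite /= oppr_eq0 invr_eq0 lt_eqF //; congr Some; field.
      by rewrite lt_eqF // oppr_eq0 oner_eq0.
    move=> ->; rewrite /= lt_eqF // mul1r mulN1r.
    by rewrite -/S qneginvK.
  - rewrite [LHS]/=.
    have -> : 0 = 0%:~R / 1%:R :> rat by rewrite mul0r.
    by rewrite qrat_of_num //= eqxx.
move: y => {}x x0; have [a [b [b0 ab e]]] := rat_coprime x.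
have a0 : 0 < a.
  by move: x0; rewrite e pmulr_lgt0 ?ltr0z // invr_gt0 ltr0n.
case: a a0 ab e => // a a0 ab e.
have a0' : (0 < a)%N by lia.
have e' : qneginv 1 (Some x) = Some ((- b%:Z)%:~R / a%:R).
  rewrite /= gt_eqF // mul1r e; congr Some.
  rewrite rmorphN /= -!pmulrn; have : a%:R != 0 :> rat by rewrite pnatr_eq0; lia.
  have : b%:R != 0 :> rat by rewrite pnatr_eq0; lia.
  by move: (b%:R : rat) (a%:R : rat) => u v u0 v0; field; rewrite u0 v0.
rewrite e' e !qrat_of_num ?gS // ?abszN //.
by rewrite coprime_sym.
Qed.

Lemma is_qrat_unique f1 f2 : is_qrat q f1 -> is_qrat q f2 -> f1 =1 f2.
Proof.
move=> [z1 t1 s1] [z2 t2 s2]; apply: P1Q_ind => [|x e|x|x e].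
- by rewrite z1 z2.
- by rewrite t1 t2 e.
- by rewrite t1 t2 => /(can_inj qshiftK).
- by rewrite s1 s2 e.
Qed.

End Existence.

Section Fractions.
Local Open Scope quotient_scope.

Lemma frac_repr (R : idomainType) (f : {fraction R}) :
  tofrac (repr f).1 / tofrac (repr f).2 = f.
Proof.
have e0 : (repr f).2 != 0 by exact: denom_ratioP.
apply: (@mulIf _ (tofrac (repr f).2)); first by rewrite tofrac_eq0.
rewrite divfK ?tofrac_eq0 // -[X in X * _]reprK.
unlock tofrac; rewrite -[RHS]FracField.pi_mul; apply/eqmodP.
rewrite /= FracField.equivfE /FracField.mulf !numden_Ratio ?oner_neq0 ?mulr1 //.
by rewrite mul1r.
Qed.

Lemma frac_cross (R : idomainType) (n e p d : R) : e != 0 -> d != 0 ->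
  tofrac n / tofrac e = tofrac p / tofrac d :> {fraction R} -> n * d = e * p.
Proof.
have gen (K : fieldType) (a b u v : K) : b != 0 -> v != 0 -> a / b = u / v -> a * v = b * u.
  by move=> b0 v0 /eqP; rewrite eqr_div // => /eqP ->; rewrite mulrC.
move=> e0 d0 /gen h; apply/eqP; rewrite -tofrac_eq !tofracM; apply/eqP/h.
  by rewrite tofrac_eq0.
by rewrite tofrac_eq0.
Qed.

End Fractions.

Notation Qq := {fraction {poly rat}}.
Definition qvar : Qq := tofrac 'X.

Lemma qvar_neq0 : qvar != 0.
Proof. by rewrite tofrac_eq0 polyX_eq0. Qed.

Lemma ex_qrat : exists f, is_qrat qvar f.
Proof. by exists (@qrat_of Qq qvar); exact: (qrat_ofP qvar_neq0). Qed.

(* x |-> [x]_q, the unique solution of its functional equations; the explicit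
   continued fraction above only serves to prove that it exists. *)
Definition qrat : P1 rat -> P1 Qq := sval (cid ex_qrat).

Lemma qratP : is_qrat qvar qrat.
Proof. exact: svalP (cid ex_qrat). Qed.

Lemma qrat_unique f : is_qrat qvar f -> f =1 qrat.
Proof. by move=> hf; exact: (is_qrat_unique qvar_neq0 hf qratP). Qed.

Definition crq (x : 4.-tuple (P1 rat)) : Qq := cr [tuple of map qrat x].

Section Evaluation.
Variable R : realType.

(* The value of f at q = t, read off the reduced form of f: the representative
   [repr f] need not be in lowest terms and could vanish spuriously at t.
   At the poles of f the value is 0. *)
Definition reval (f : Qq) (t : R) : R :=
  let n := (repr f).1 in let d := (repr f).2 in
  (map_poly ratr (n %/ gcdp n d)).[t] / (map_poly ratr (d %/ gcdp n d)).[t].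

Lemma reval_frac (p d : {poly rat}) (t : R) : (map_poly ratr d).[t] != 0 ->
  reval (tofrac p / tofrac d) t = (map_poly ratr p).[t] / (map_poly ratr d).[t].
Proof.
move=> dt0; have d0 : d != 0 by apply: contraNneq dt0 => ->; rewrite rmorph0 horner0.
rewrite /reval; set f := tofrac p / _.
set n := (repr f).1; set e := (repr f).2.
have e0 : e != 0 by exact: denom_ratioP.
have h : n * d = e * p.
  by apply: frac_cross => //; exact: frac_repr.
have g0 : gcdp n e != 0 by rewrite gcdp_eq0 negb_and e0 orbT.
have hn := divpK (dvdp_gcdl n e); have he := divpK (dvdp_gcdr n e).
set n' := n %/ _ in hn *; set e' := e %/ _ in he *.
have cop : coprimep n' e' by rewrite coprimep_div_gcd // e0 orbT.
have h' : n' * d = e' * p.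
  by apply: (mulIf g0); rewrite mulrAC hn mulrAC he.
have /(congr1 (fun r => (map_poly (ratr : rat -> R) r).[t])) := h'.
rewrite !rmorphM !hornerM => ht.
have e't : (map_poly (ratr : rat -> R) e').[t] != 0.
  apply/eqP => e't0; move: ht; rewrite e't0 mul0r => /eqP.
  rewrite mulf_eq0 (negPf dt0) orbF => /eqP n't0.
  have [[u v] /= /eqpP [[a b] /= /andP [a0 b0] E]] := Bezoutp n' e'.
  move: cop; rewrite /coprimep => /eqP sz.
  have /size_poly1P [c c0 gc] : size (gcdp n' e') == 1%N by rewrite sz.
  move/(congr1 (fun r => (map_poly (ratr : rat -> R) r).[t])): E.
  rewrite gc !(map_polyZ, rmorphD, rmorphM) /= !(hornerZ, hornerD, hornerM).
  rewrite n't0 e't0 !mulr0 addr0 mulr0 map_polyC hornerC => /esym/eqP.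
  by rewrite -rmorphM fmorph_eq0 mulf_eq0 (negPf b0) (negPf c0).
by apply/eqP; rewrite eqr_div // ht mulrC.
Qed.

(* The coefficient of h^n / n! in the Taylor expansion at h = 0 of cr_q, q = e^h;
   by [crq_regular] there is no pole at h = 0 when the points are distinct. *)
Definition cr_taylor (n : nat) (x : 4.-tuple (P1 rat)) : R :=
  derive1n n (fun h : R => reval (crq x) (expR h)) 0.

End Evaluation.

Section Point.
Variable K : fieldType.

Definition col2 (R : pzSemiRingType) (a b : R) : 'cV[R]_2 := \col_i [:: a; b]`_i.

Lemma col2_eq0 (a b : K) : (col2 a b == 0) = (a == 0) && (b == 0).
Proof.
apply/eqP/andP => [/colP h|[/eqP -> /eqP ->]].
  by have := h 0; have := h 1; rewrite !mxE /= => -> ->.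
by apply: colP2; rewrite !mxE.
Qed.

Lemma point_col2 (a b : K) :
  P1_of (col2 a b) = if b == 0 then None else Some (a / b).
Proof. by rewrite /P1_of !mxE. Qed.

Lemma qshift_col2 (c a b : K) :
  qshift c (P1_of (col2 a b)) = P1_of (col2 (c * a + b) b).
Proof.
rewrite !point_col2; case: eqVneq => //= b0; congr Some.
by rewrite mulrDl divff // mulrA.
Qed.

Lemma point_scale (c a b : K) : c != 0 ->
  P1_of (col2 (c * a) (c * b)) = P1_of (col2 a b).
Proof.
move=> c0; rewrite !point_col2 mulf_eq0 (negPf c0) /=; case: eqVneq => // b0.
by congr Some; rewrite -mulf_div divff // mul1r.
Qed.

Lemma qneginv_col2 (c a b : K) : c != 0 -> col2 a b != 0 ->
  qneginv c (P1_of (col2 a b)) = P1_of (col2 (- b) (c * a)).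
Proof.
move=> c0; rewrite col2_eq0 !point_col2 mulf_eq0 (negPf c0) /=.
case: (eqVneq b 0) => [->|b0] /=; first by rewrite andbT => /negPf ->; rewrite oppr0 mul0r.
move=> _; rewrite mulf_eq0 invr_eq0 (negPf b0) orbF; case: eqVneq => // a0.
by congr Some; field; rewrite a0 b0 c0.
Qed.

Lemma det_point_neq0 (X Y : 'cV[K]_2) : X != 0 -> Y != 0 -> P1_of X != P1_of Y ->
  \det (row_mx X Y) != 0.
Proof.
move=> X0 Y0; apply: contra; rewrite det_cols subr_eq0 => /eqP e.
have nz (Z : 'cV[K]_2) : Z != 0 -> Z 1 0 == 0 -> Z 0 0 != 0.
  by move=> Z0 /eqP Z1; apply: contra Z0 => /eqP Z00; apply/eqP; apply: colP2; rewrite mxE.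
rewrite /P1_of; have [X1|X1] := eqVneq (X 1 0) 0.
  move/eqP: e; rewrite X1 mulr0 mulf_eq0 => /orP[/eqP h|/eqP ->]; last by rewrite eqxx.
  by have := nz _ X0; rewrite X1 h !eqxx => /(_ isT).
have [Y1|Y1] := eqVneq (Y 1 0) 0.
  move/esym/eqP: e; rewrite Y1 mulr0 mulf_eq0 (negPf X1) orbF => /eqP h.
  by have := nz _ Y0; rewrite Y1 h !eqxx => /(_ isT).
by apply/eqP; congr Some; apply/eqP; rewrite eqr_div // e.
Qed.

End Point.

(* [x]_q specialises to x at q = 1: some homogeneous coordinates of [x]_q become
   homogeneous coordinates of x. *)
Lemma qrat_lift (x : P1 rat) : exists ab : {poly rat} * {poly rat},
  [/\ col2 ab.1.[1] ab.2.[1] != 0, P1_of (col2 ab.1.[1] ab.2.[1]) = x &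
      P1_of (col2 (tofrac ab.1) (tofrac ab.2)) = qrat x].
Proof.
have [q0 qT qS] := qratP; have v0 := qvar_neq0.
move: x; apply: P1Q_ind => [|x [[a b] /= [n e1 e2]]|x [[a b] /= [n e1 e2]]|x [[a b] /= [n e1 e2]]].
- exists (0, 1); rewrite /= !hornerE col2_eq0 oner_eq0 andbF; split => //.
    by rewrite point_col2 oner_eq0 mul0r.
  by rewrite q0 point_col2 tofrac0 tofrac1 oner_eq0 mul0r.
- exists ('X * a + b, b); rewrite /= !hornerE; split.
  + move: n; rewrite !col2_eq0; apply: contra => /andP[h /eqP hb].
    by move: h; rewrite hb addr0 => ->; rewrite eqxx.
  + by rewrite -e1 qshift_col2 mul1r.
  by rewrite qT -e2 qshift_col2 tofracD tofracM.
- exists (a - b, 'X * b); rewrite /= !hornerE; split.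
  + move: n; rewrite !col2_eq0; apply: contra => /andP[h /eqP hb].
    by move: h; rewrite hb subr0 => ->; rewrite eqxx.
  + apply: (can_inj (qshiftK (oner_neq0 _))).
    by rewrite qshift_col2 -e1 mul1r subrK.
  apply: (can_inj (qshiftK v0)).
  rewrite qshift_col2 -qT -e2 tofracB tofracM -mulrDr subrK.
  by rewrite point_scale.
exists (- b, 'X * a); rewrite /= !hornerE; split.
- by move: n; rewrite !col2_eq0 oppr_eq0 andbC.
- by rewrite -e1 qneginv_col2 ?oner_neq0 // mul1r.
have nF : col2 (tofrac a) (tofrac b) != 0.
  rewrite col2_eq0 !tofrac_eq0; move: n; rewrite col2_eq0; apply: contra.
  by move=> /andP[/eqP -> /eqP ->]; rewrite horner0 eqxx.
by rewrite qS -e2 (qneginv_col2 v0 nF) tofracN tofracM.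
Qed.

Lemma crq_regular (x : 4.-tuple (P1 rat)) : uniq x ->
  exists p d : {poly rat},
  [/\ crq x = tofrac p / tofrac d, d.[1] != 0 & cr x = p.[1] / d.[1]].
Proof.
move=> ux.
have /choice [X hX] : forall i, _ := fun i => qrat_lift (tnth x i).
pose D i j := (X i).1 * (X j).2 - (X j).1 * (X i).2.
exists (D 0 2 * D 1 3), (D 0 3 * D 1 2).
have D1 i j : (D i j).[1] =
    \det (row_mx (col2 (X i).1.[1] (X i).2.[1]) (col2 (X j).1.[1] (X j).2.[1])).
  by rewrite det_cols !mxE /= /D !hornerE.
have nD i j : i != j -> (D i j).[1] != 0.
  move=> ij; rewrite D1; have [ni ei _] := hX i; have [nj ej _] := hX j.
  apply: det_point_neq0; rewrite // ei ej; apply: contra ij => /eqP h.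
  by apply/eqP/(tuple_uniqP _ ux).
split.
- rewrite /crq (@cr_lift _ (fun i => col2 (tofrac (X i).1) (tofrac (X i).2))).
  + rewrite /crlift /= !det_cols !mxE /= !(tofracM, tofracB); ring.
  + move=> i; have [n _ _] := hX i; rewrite col2_eq0 !tofrac_eq0.
    by move: n; rewrite col2_eq0; apply: contra => /andP[/eqP -> /eqP ->]; rewrite horner0 eqxx.
  by move=> i; have [_ _ ->] := hX i; rewrite tnth_map.
- by rewrite hornerM mulf_neq0 ?nD.
rewrite (@cr_lift _ (fun i => col2 (X i).1.[1] (X i).2.[1])).
- by rewrite !hornerM !D1.
- by move=> i; have [n _ _] := hX i.
by move=> i; have [_ n _] := hX i.
Qed.

Lemma cr_taylor0 (R : realType) (x : 4.-tuple (P1 rat)) : uniq x ->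
  cr_taylor R 0 x = ratr (cr x).
Proof.
move=> /crq_regular [p [d [e d1 ->]]].
have h1 (r : {poly rat}) : (map_poly ratr r).[1] = ratr r.[1] :> R.
  by rewrite -(rmorph1 (@ratr R)) horner_map.
rewrite /cr_taylor /derive1n /= expR0 e reval_frac h1 ?fmorph_eq0 //.
by rewrite h1 fmorph_div.
Qed.

(* For M invertible this is the action of GL(2, Z), which factors through
   PGL(2, Z) = GL(2, Z) / {+1, -1}. *)
Definition act_quad (M : 'M[int]_2) (x : 4.-tuple (P1 rat)) :
    4.-tuple (P1 rat) :=
  [tuple of map (moebius (map_mx intr M)) x].

Definition quads : set (4.-tuple (P1 rat)) := [set x | uniq x]%classic.

Definition alg_independent (K : fieldType) (T : Type) (D : set T)
    (J : nat -> T -> K) : Prop :=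
  forall N : nat, ~ exists P : mpoly N K,
    P != 0 /\ forall x, D x -> meval (fun i : 'I_N => J i x) P = 0.

(* Main.v *)
From HB Require Import structures.
Require Import Defs.
From mathcomp Require Import all_boot all_order all_algebra.
From mathcomp Require Import generic_quotient fraction.
From mathcomp Require Import all_classical all_reals all_analysis.
From mathcomp Require Import complex ring zify.
From mathcomp.multinomials Require Import -(notations) mpoly.

(* Invariance: T : y |-> q y + 1 and S : y |-> - 1/(q y) are homographies, so
   cr_q is invariant under T and S; x |-> - x turns q into 1/q, i.e. h into - h,
   which does not affect the even Taylor coefficients.  These three maps generate
   PGL(2, Z).

   Independence: cr_q(inf, 0; 1, x) = [x]_q, so it suffices to study the jets at
   h = 0 of [x]_q for x in the orbit of 0 under words in T^n and S.  With q = exp h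
   the jets of T^n depend polynomially on n, so a polynomial relation P that holds
   on this orbit persists when the exponents n are replaced by arbitrary complex
   numbers s.  The group G generated by S and all T^s is much larger than the
   modular group.  If s t = 2, then (S T^s S T^t)^2 is a scalar modulo h^2, and in
   general not modulo h^3; its iterated commutators with conjugates of itself are
   scalar modulo h^(2j) with nonscalar part of order exactly 2j, for every j > 0.
   Such an element fixes the coefficients of order < 2j and moves the one of order
   2j by a nonzero constant.  Iterating it shows, by descending induction on j,
   that P vanishes whatever the coefficients of order 2j, 2j + 2, ..., hence
   everywhere. *)

Set Implicit Arguments.
Unset Strict Implicit.
Unset Printing Implicit Defensive.

Import Order.TTheory GRing.Theory Num.Theory.
Import numFieldNormedType.Exports.

Local Open Scope ring_scope.

(** * Polynomial functions and congruences modulo a power of X *)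

(** Uniqueness of base [D] digits, peeled off by reduction modulo [D]; it makes the Kronecker
    substitution injective on monomials. *)
Lemma digits_inj (D n : nat) (f g : nat -> nat) :
  (forall i, f i < D)%N -> (forall i, g i < D)%N ->
  (\sum_(i < n) f i * D ^ i = \sum_(i < n) g i * D ^ i)%N ->
  forall i, (i < n)%N -> f i = g i.
Proof.
elim: n f g => // n IH f g hf hg; rewrite !big_ord_recl !expn0 !muln1.
have shift k : (\sum_(i < n) k (bump 0 i) * D ^ bump 0 i =
                D * \sum_(i < n) k i.+1 * D ^ i)%N.
  by rewrite big_distrr; apply: eq_bigr => i _; rewrite expnS mulnCA.
rewrite /= !shift => e.
have D0 : (0 < D)%N by apply: leq_ltn_trans (hf 0).
have e0 : f 0 = g 0.
  have := congr1 (modn^~ D) e; rewrite /= ![(_ + D * _)%N]addnC !(mulnC D) !modnMDl.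
  by rewrite !modn_small.
move/eqP: e; rewrite e0 eqn_add2l eqn_pmul2l // => /eqP e [//|i] ilt.
by apply: (IH (f \o succn) (g \o succn)) => // k; [exact: hf|exact: hg].
Qed.

Lemma poly_infinite_roots (F : numDomainType) (p : {poly F}) (u : nat -> F) :
  injective u -> (forall n, p.[u n] = 0) -> p = 0.
Proof.
move=> inju pu; apply/eqP; apply/idPn => p0.
have := max_poly_roots p0 (rs := map u (iota 0 (size p))).
rewrite size_map size_iota ltnn map_inj_uniq // iota_uniq => /(_ _ isT) h.
by apply: notF; apply: h; apply/allP => _ /mapP[n _ ->]; rewrite rootE pu.
Qed.

Section MPolyFunctions.
Variables (F : numFieldType) (N : nat).
Implicit Types (P : mpoly N F) (t : 'I_N -> F).

(* Kronecker substitution t_i = u^(D^i), with D larger than all exponents. *)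
Lemma mpoly_fun_eq0 P : (forall t, meval t P = 0) -> P = 0.
Proof.
move=> P0; pose D := (\max_(m <- msupp P) \max_(i < N) m i).+1.
have mD m i : m \in msupp P -> (m i < D)%N.
  move=> mP; rewrite ltnS (big_rem m) //=; apply: leq_trans (leq_maxl _ _).
  exact: (@leq_bigmax _ (fun i : 'I_N => m i)).
pose code (m : multinom N) := (\sum_(i < N) m i * D ^ i)%N.
have code_inj m m' : m \in msupp P -> m' \in msupp P -> code m = code m' -> m = m'.
  move=> mP mP'; pose f (m : multinom N) j := if insub j is Some i then m i else 0%N.
  have fD k : k \in msupp P -> forall j, (f k j < D)%N.
    by move=> kP j; rewrite /f; case: insub => // i; apply: mD.
  have codeE k : code k = (\sum_(i < N) f k i * D ^ i)%N.
    by apply: eq_bigr => i _; rewrite /f valK.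
  rewrite !codeE => /(digits_inj (fD _ mP) (fD _ mP')) e.
  by apply/mnmP => i; have := e i (ltn_ord i); rewrite /f valK.
pose p : {poly F} := \sum_(m <- msupp P) mcoeff m P *: 'X^(code m).
have p0 : p = 0.
  apply: (@poly_infinite_roots _ _ (fun n => n%:R)) => [n n' /eqP|n].
    by rewrite eqr_nat => /eqP.
  rewrite -[RHS](P0 (fun i => n%:R ^+ (D ^ i))) mevalE horner_sum.
  apply: eq_bigr => m _; rewrite hornerZ hornerXn; congr (_ * _).
  rewrite /code expr_sum; apply: eq_bigr => i _.
  by rewrite -exprM mulnC.
apply/eqP; rewrite -msupp_eq0; case E : (msupp P) => [//|m s].
have mP : m \in msupp P by rewrite E mem_head.
have := congr1 (fun p : {poly F} => p`_(code m)) p0.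
rewrite coef0 coef_sum (bigD1_seq m) ?msupp_uniq //= coefZ coefXn eqxx mulr1.
rewrite big1_seq ?addr0 => [/eqP|m' /andP[m'm m'P]]; first by rewrite mcoeff_eq0 mP.
rewrite coefZ coefXn; case: eqP => [/code_inj|]; rewrite ?mulr0 // => e.
by rewrite -(e mP m'P) eqxx in m'm.
Qed.

Lemma meval_line P (i : 'I_N) t :
  exists p : {poly F}, forall u, meval (fun j => if j == i then u else t j) P = p.[u].
Proof.
exists (\sum_(m <- msupp P) (mcoeff m P * \prod_(j | j != i) t j ^+ m j) *: 'X^(m i)).
move=> u; rewrite mevalE horner_sum; apply: eq_bigr => m _.
rewrite hornerZ hornerXn (bigD1 i) //= eqxx -mulrA; congr (_ * _).
by rewrite mulrC; congr (_ * _); apply: eq_bigr => j /negPf ->.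
Qed.

End MPolyFunctions.

(** * Truncated power series, as polynomials modulo a power of ['X] *)

Section Congruence.
Variable F : fieldType.
Implicit Types a b c : {poly F}.

Definition eqmodX n a b := exists c, a = b + c * 'X^n.

Lemma eqmodXP n a b : eqmodX n a b <-> forall k, (k < n)%N -> a`_k = b`_k.
Proof.
split=> [[c ->] k kn|e]; first by rewrite coefD coefMXn kn addr0.
exists (drop_poly n (a - b)); rewrite -{1}(subrK b a) addrC; congr (_ + _).
rewrite -{1}(poly_take_drop n (a - b)); suff -> : take_poly n (a - b) = 0 by rewrite add0r.
apply/polyP => k; rewrite coef_take_poly coef0; case: ltnP => // kn.
by rewrite coefB e ?subrr.
Qed.

Lemma eqmodX_refl n a : eqmodX n a a.
Proof. by exists 0; rewrite mul0r addr0. Qed.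

Lemma eqmodX_sym n a b : eqmodX n a b -> eqmodX n b a.
Proof. by case=> c ->; exists (- c); ring. Qed.

Lemma eqmodX_trans n b a c : eqmodX n a b -> eqmodX n b c -> eqmodX n a c.
Proof. by case=> [d ->] [e ->]; exists (d + e); ring. Qed.

Lemma eqmodXD n a b a' b' :
  eqmodX n a b -> eqmodX n a' b' -> eqmodX n (a + a') (b + b').
Proof. by case=> [d ->] [e ->]; exists (d + e); ring. Qed.

Lemma eqmodXN n a b : eqmodX n a b -> eqmodX n (- a) (- b).
Proof. by case=> [d ->]; exists (- d); ring. Qed.

Lemma eqmodXB n a b a' b' :
  eqmodX n a b -> eqmodX n a' b' -> eqmodX n (a - a') (b - b').
Proof. by move=> h /eqmodXN; apply: eqmodXD. Qed.

Lemma eqmodXM n a b a' b' :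
  eqmodX n a b -> eqmodX n a' b' -> eqmodX n (a * a') (b * b').
Proof. by case=> [d ->] [e ->]; exists (b * e + d * b' + d * e * 'X^n); ring. Qed.

Lemma eqmodXMl n c a b : eqmodX n a b -> eqmodX n (c * a) (c * b).
Proof. by apply: eqmodXM; apply: eqmodX_refl. Qed.

Lemma eqmodXMr n c a b : eqmodX n a b -> eqmodX n (a * c) (b * c).
Proof. by move=> h; apply: eqmodXM h (eqmodX_refl _ _). Qed.

Lemma eqmodX_le m n a b : (m <= n)%N -> eqmodX n a b -> eqmodX m a b.
Proof. by move=> mn [c ->]; exists (c * 'X^(n - m)); rewrite -mulrA -exprD subnK. Qed.

Lemma eqmodX_X n a b : eqmodX n.+1 ('X * a) ('X * b) -> eqmodX n a b.
Proof. by move/eqmodXP => e; apply/eqmodXP => k kn; have := e k.+1 kn; rewrite !coefXM. Qed.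

Lemma eqmodX_coef0 n a b : (0 < n)%N -> eqmodX n a b -> a`_0 = b`_0.
Proof. by move=> n0 /eqmodXP ->. Qed.

Lemma coef0M a b : (a * b)`_0 = a`_0 * b`_0.
Proof. by rewrite -!horner_coef0 hornerM. Qed.

Lemma coprimep_Xn n c : c`_0 != 0 -> coprimep 'X^n c.
Proof.
move=> c0; apply: coprimep_expl; rewrite -['X]subr0 -(polyC0 F).
by rewrite coprimep_sym coprimep_XsubC rootE horner_coef0.
Qed.

(** A polynomial with nonzero constant term is coprime to ['X^n], hence invertible modulo it. This
    gives cancellation here and, through Bezout, division in [eqmodX_div]. *)
Lemma eqmodXI n c a b : c`_0 != 0 -> eqmodX n (c * a) (c * b) -> eqmodX n a b.
Proof.
move=> /(coprimep_Xn n) cc [d e]; have : 'X^n %| c * (a - b).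
  by rewrite mulrBr e addrAC subrr add0r dvdp_mull.
rewrite Gauss_dvdpr // => /dvdpP [f ef].
by exists f; rewrite -ef; ring.
Qed.

Lemma eqmodX_div n (p r : {poly F}) : r`_0 != 0 -> exists g, eqmodX n (g * r) p.
Proof.
move=> /(coprimep_Xn n); rewrite coprimep_sym => /Bezout_eq1_coprimepP [[u v] /= e].
by exists (p * u), (- p * v); rewrite -[in RHS](mulr1 p) -{1}e; ring.
Qed.

End Congruence.

(** * The group generated by S and the real powers of T, modulo a power of h *)

Section TruncatedGroup.
Variables (F : numFieldType) (K : nat).
Implicit Types (s t : F) (p r c : {poly F}).

(* [texp s] is exp (s h) and [tquot s] is (exp (s h) - 1) / h, with h = 'X;
   the extra coefficient of [texp] allows divisions by 'X. *)
Definition texp s : {poly F} := \poly_(k < K.+1) (s ^+ k / k`!%:R).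
Definition tquot s : {poly F} := \poly_(k < K) (s ^+ k.+1 / k.+1`!%:R).

Lemma X_tquot s : 'X * tquot s = texp s - 1.
Proof.
apply/polyP => -[|k]; rewrite coefXM coefB coef1 !coef_poly /=.
  by rewrite expr0 fact0 divr1 subrr.
by rewrite ltnS subr0.
Qed.

(** The binomial theorem, coefficient by coefficient below the truncation order. *)
Lemma texpD s t : eqmodX K.+1 (texp s * texp t) (texp (s + t)).
Proof.
apply/eqmodXP => k kK; rewrite coefM coef_poly kK addrC exprDn mulr_suml.
apply: eq_bigr => i _; have ik : (i <= k)%N by rewrite -ltnS.
rewrite !coef_poly !(leq_ltn_trans _ kK) ?leq_subr // -mulr_natr.
have /(congr1 (fun n => n%:R : F)) := bin_fact ik; rewrite !natrM => <-.
have f0 n : n`!%:R != 0 :> F by rewrite pnatr_eq0 -lt0n fact_gt0.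
have b0 : ('C(k, i))%:R != 0 :> F by rewrite pnatr_eq0 -lt0n bin_gt0.
by field; rewrite !f0 b0.
Qed.

Lemma texp0 : texp 0 = 1.
Proof.
apply/polyP => k; rewrite coef_poly coef1 expr0n; case: k => [|k] /=.
  by rewrite fact0 divr1.
by rewrite mul0r; case: ifP.
Qed.

Lemma tquot0 : tquot 0 = 0.
Proof. by apply/polyP => k; rewrite coef_poly coef0 expr0n mul0r; case: ifP. Qed.

(** The translation part of T_s T_t = T_(s + t). Multiplication by ['X] reduces it to the addition
    law of [texp]. *)
Lemma tquotD s t : eqmodX K (texp s * tquot t + tquot s) (tquot (s + t)).
Proof.
apply: eqmodX_X; rewrite mulrDr mulrCA !X_tquot mulrBr mulr1.
have -> : texp s * texp t - texp s + (texp s - 1) = texp s * texp t - 1 by ring.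
by apply: eqmodXB (texpD _ _) (eqmodX_refl _ _).
Qed.

Lemma texpN s : eqmodX K (texp s * texp (- s)) 1.
Proof. by apply: eqmodX_le (leqnSn K) _; rewrite -texp0 -(subrr s); apply: texpD. Qed.

Lemma tquotN s : eqmodX K (texp s * tquot (- s)) (- tquot s).
Proof.
have := tquotD s (- s); rewrite subrr tquot0 => /eqmodXB /(_ (eqmodX_refl _ (tquot s))).
by rewrite addrK sub0r.
Qed.

Lemma texp_coef0 s : (texp s)`_0 = 1.
Proof. by rewrite coef_poly expr0 fact0 divr1. Qed.

Lemma tquot_coef0 s : (0 < K)%N -> (tquot s)`_0 = s.
Proof. by move=> K0; rewrite coef_poly K0 expr1 divr1. Qed.

(* Homogeneous coordinates (p : r) for the point p / r.  Here S is y |-> -1/(qy)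
   and T_s is the s-th power of y |-> q y + 1, for q = exp h. *)
Definition qS (y : {poly F} * {poly F}) := (- y.2, texp 1 * y.1).
Definition qT s (y : {poly F} * {poly F}) :=
  (texp s * tquot 1 * y.1 + tquot s * y.2, tquot 1 * y.2).

Fixpoint qword (l : seq F) : {poly F} * {poly F} :=
  if l is s :: l' then qT s (qS (qword l')) else (0, 1).

(** The orbit of 0 = (0 : 1), with coordinates taken modulo ['X^K] and up to a factor invertible as
    a power series. *)
Definition qorbit p r := exists l c,
  [/\ c`_0 != 0, eqmodX K p (c * (qword l).1) & eqmodX K r (c * (qword l).2)].

Hypothesis K0 : (0 < K)%N.

Lemma tquot1_coef0 : (tquot 1)`_0 != 0.
Proof. by rewrite tquot_coef0 ?oner_neq0. Qed.

Lemma qorbit_scale c p r p' r' : c`_0 != 0 -> qorbit p r ->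
  eqmodX K p' (c * p) -> eqmodX K r' (c * r) -> qorbit p' r'.
Proof.
move=> c0 [l [d [d0 ep er]]] ep' er'; exists l, (c * d); split.
- by rewrite coef0M mulf_neq0.
- by apply: eqmodX_trans ep' _; rewrite -mulrA; apply: eqmodXMl.
- by apply: eqmodX_trans er' _; rewrite -mulrA; apply: eqmodXMl.
Qed.

Lemma qorbit_unscale c p r : c`_0 != 0 -> qorbit (c * p) (c * r) -> qorbit p r.
Proof.
move=> c0 [l [d [d0 ep er]]]; have [e [f ef]] := eqmodX_div K 1 c0.
have e0 : e`_0 != 0.
  have := congr1 (fun p : {poly F} => p`_0) ef; rewrite coefD coefMXn K0 addr0 coef0M coef1 /=.
  by move=> h; apply: contra_eq_neq h => ->; rewrite mul0r eq_sym oner_neq0.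
exists l, (e * d); split; first by rewrite coef0M mulf_neq0.
  apply: (eqmodXI c0); apply: eqmodX_trans ep _; rewrite !mulrA (mulrC c) ef.
  by exists (- f * d * (qword l).1); ring.
apply: (eqmodXI c0); apply: eqmodX_trans er _; rewrite !mulrA (mulrC c) ef.
by exists (- f * d * (qword l).2); ring.
Qed.

Lemma qorbit_ext p r p' r' : p = p' -> r = r' -> qorbit p r -> qorbit p' r'.
Proof. by move=> -> ->. Qed.

Lemma qorbit_cons s p r : qorbit p r ->
  qorbit (tquot s * texp 1 * p - texp s * tquot 1 * r) (tquot 1 * texp 1 * p).
Proof.
case=> l [c [c0 [d ->] [e ->]]]; exists (s :: l), c; split => //=.
  by exists (tquot s * texp 1 * d - texp s * tquot 1 * e); ring.
by exists (tquot 1 * texp 1 * d); ring.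
Qed.

(** Words only offer the product T_s S. For s = 0 the factor T_0 is multiplication of both
    coordinates by [tquot 1], which can be divided out. *)
Lemma qorbit_S p r : qorbit p r -> qorbit (- r) (texp 1 * p).
Proof.
move=> /(qorbit_cons 0); rewrite tquot0 texp0 => h.
apply: (@qorbit_unscale (tquot 1)); first exact: tquot1_coef0.
by apply: qorbit_ext h; ring.
Qed.

Lemma qorbit_SV p r : qorbit p r -> qorbit r (- (texp 1 * p)).
Proof.
move=> /qorbit_S h; apply: (@qorbit_scale (-1) _ _ _ _ _ h).
- by rewrite coefN coef1 oppr_eq0 oner_neq0.
- by rewrite mulN1r opprK; apply: eqmodX_refl.
- by rewrite mulN1r; apply: eqmodX_refl.
Qed.

(** T_s is obtained as (T_s S) S^-1. As a map it is y |-> q^s y + (q^s - 1)/(q - 1), and the factor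
    [tquot 1] in both coordinates clears the denominator. *)
Lemma qorbit_T s p r : qorbit p r ->
  qorbit (texp s * tquot 1 * p + tquot s * r) (tquot 1 * r).
Proof.
move=> /qorbit_SV /(qorbit_cons s) h; apply: (@qorbit_unscale (texp 1)).
  by rewrite texp_coef0 oner_neq0.
by apply: qorbit_ext h; ring.
Qed.

(** The inverse of T_s is T_(-s); multiplication by [texp s] brings it to the form of the
    adjugate. *)
Lemma qorbit_TV s p r : qorbit p r ->
  qorbit (tquot 1 * p - tquot s * r) (texp s * tquot 1 * r).
Proof.
move=> /(qorbit_T (- s)) h; apply: (@qorbit_scale (texp s) _ _ _ _ _ h).
- by rewrite texp_coef0 oner_neq0.
- rewrite mulrDr !mulrA; apply: eqmodX_sym; apply: eqmodXD.
    by rewrite -mulrA -[X in eqmodX _ _ X]mul1r; apply: eqmodXM (texpN s) (eqmodX_refl _ _).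
  by rewrite -mulNr; apply: eqmodXMr (tquotN s).
- by rewrite mulrA; apply: eqmodX_refl.
Qed.

(* Since coordinates are homogeneous, the adjugate of [[a, b], [c, d]] stands for its inverse. *)
Definition stab (a b c d : {poly F}) := forall p r, qorbit p r ->
  qorbit (a * p + b * r) (c * p + d * r) /\ qorbit (d * p - b * r) (- (c * p) + a * r).

Lemma stab_ext a b c d a' b' c' d' : a = a' -> b = b' -> c = c' -> d = d' ->
  stab a b c d -> stab a' b' c' d'.
Proof. by move=> -> -> -> ->. Qed.

Lemma stab_mul a b c d a' b' c' d' : stab a b c d -> stab a' b' c' d' ->
  stab (a * a' + b * c') (a * b' + b * d') (c * a' + d * c') (c * b' + d * d').
Proof.
move=> h h' p r o; split.
  have [+ _] := h' _ _ o; case/h => + _.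
  by apply: qorbit_ext; ring.
have [_ +] := h _ _ o; case/h' => _.
by apply: qorbit_ext; ring.
Qed.

Lemma stab_adj a b c d : stab a b c d -> stab d (- b) (- c) a.
Proof.
move=> h p r /h [h1 h2]; split; last by rewrite !mulNr !opprK.
by rewrite !mulNr.
Qed.

Lemma stab_T s : stab (texp s * tquot 1) (tquot s) 0 (tquot 1).
Proof.
move=> p r o; rewrite mul0r oppr0 !add0r; split; first exact: qorbit_T.
exact: qorbit_TV.
Qed.

Lemma stab_S : stab 0 (-1) (texp 1) 0.
Proof.
move=> p r o; rewrite !mul0r !add0r !addr0 !mulN1r opprK; split.
  exact: qorbit_S.
exact: qorbit_SV.
Qed.

(* Elements of [stab] congruent to a scalar modulo 'X^n, with direction
   [[x, y], [z, 0]], modulo scalars, in degree n. *)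
Definition graded n (x y z : F) := exists a b c d : {poly F},
  [/\ stab (d + 'X^n * a) ('X^n * b) ('X^n * c) d, d`_0 != 0,
      a`_0 = x, b`_0 = y & c`_0 = z].

(** At h = 0 the matrix of T_s is [[1, s], [0, 1]]. The formula is its adjoint action on [[x, y],
    [z, 0]], after the scalar - s z has been subtracted. *)
Lemma graded_conj n x y z s : (0 < n)%N -> graded n x y z ->
  graded n (x + 2 * s * z) (y - s * x - s ^+ 2 * z) z.
Proof.
move=> n0 [a [b [c [d [h d0 <- <- <-]]]]].
have := stab_mul (stab_mul (stab_T s) h) (stab_adj (stab_T s)).
have u0 : ('X^n : {poly F})`_0 = 0 by rewrite coefXn ltn_eqF.
rewrite /graded; set e := texp s; set v := tquot 1; set w := tquot s; set u := 'X^n in u0 * => {}h.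
have e0 : e`_0 = 1 by exact: texp_coef0.
have v0 : v`_0 = 1 by exact: tquot_coef0.
have w0 : w`_0 = s by exact: tquot_coef0.
exists (e * v ^+ 2 * a + 2%:R * v * w * c), ((e * v) ^+ 2 * b - w * e * v * a - w ^+ 2 * c),
  (v ^+ 2 * c), (e * v ^+ 2 * d - w * v * u * c); split.
- by apply: stab_ext h; ring.
- by rewrite coefB !expr2 !coef0M e0 v0 u0 mulr0 !mul1r mul0r subr0.
- by rewrite coefD !expr2 !coef0M e0 v0 w0 coefMn coef1 /=; ring.
- by rewrite !coefB !expr2 !coef0M e0 v0 w0; ring.
- by rewrite !expr2 !coef0M v0 !mul1r.
Qed.

(** To leading order, the commutator of two matrices that are scalar modulo ['X^m] and ['X^n] is a
    scalar plus ['X^(m + n)] times a multiple of the Lie bracket of their directions. Reducing the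
    bracket modulo scalars produces the factor 2. *)
Lemma graded_comm m n x y z x' y' z' : (0 < m)%N -> (0 < n)%N ->
  graded m x y z -> graded n x' y' z' -> exists2 k, k != 0 &
  graded (m + n) (k * (2 * (y * z' - y' * z))) (k * (x * y' - x' * y)) (k * (z * x' - z' * x)).
Proof.
move=> m0 n0 [a [b [c [d [h d0 <- <- <-]]]]] [a' [b' [c' [d' [h' d'0 <- <- <-]]]]].
have := stab_mul (stab_mul h h') (stab_mul (stab_adj h) (stab_adj h')).
have u0 : ('X^m : {poly F})`_0 = 0 by rewrite coefXn ltn_eqF.
have v0 : ('X^n : {poly F})`_0 = 0 by rewrite coefXn ltn_eqF.
rewrite /graded exprD; set u := 'X^m in u0 *; set v := 'X^n in v0 * => {h h'} h.
pose A := b * c' - b' * c; pose B := a * b' - a' * b; pose C := c * a' - c' * a.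
(* M M' adj(M' M) = det(M' M) + [M, M'] adj(M' M), where P = M' M *)
pose P11 := (d' + v * a') * (d + u * a) + v * b' * (u * c).
pose P12 := (d' + v * a') * (u * b) + v * b' * d.
pose P21 := v * c' * (d + u * a) + d' * (u * c).
pose P22 := v * c' * (u * b) + d' * d.
exists (d`_0 * d'`_0); first by rewrite mulf_neq0.
exists (A * P22 - B * P21 + C * P12 + A * P11), (- A * P12 + B * P11), (C * P22 + A * P21),
  (P11 * P22 - P12 * P21 + u * v * (- C * P12 - A * P11)).
have c11 : P11`_0 = d`_0 * d'`_0.
  by rewrite /P11 coefD !(coef0M, coefD) u0 v0 !mul0r !addr0 mulrC.
have c12 : P12`_0 = 0 by rewrite /P12 coefD !(coef0M, coefD) u0 v0 !mul0r mulr0 addr0.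
have c21 : P21`_0 = 0 by rewrite /P21 coefD !(coef0M, coefD) u0 v0 !mul0r mulr0 addr0.
have c22 : P22`_0 = d`_0 * d'`_0.
  by rewrite /P22 coefD !coef0M u0 v0 !mul0r add0r mulrC.
split; first by apply: stab_ext h; rewrite /A /B /C /P11 /P12 /P21 /P22; ring.
all: clearbody P11 P12 P21 P22; rewrite ?/A ?/B ?/C.
- rewrite coefD coefB !coef0M c11 c12 c22 u0 !mul0r subr0 addr0.
  by rewrite mulf_neq0 // mulf_neq0.
- by rewrite !(coefD, coefN, coef0M) c11 c12 c21 c22; ring.
- by rewrite !(coefD, coefN, coef0M) c11 c12; ring.
- by rewrite !(coefD, coefN, coef0M) c21 c22; ring.
Qed.

End TruncatedGroup.

(** * Elements that are scalar up to a prescribed even order *)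

Section Directions.
Variables (F : numFieldType) (K : nat).
Hypothesis K3 : (3 <= K)%N.
Implicit Types (a b p : {poly F}).

Let K0 : (0 < K)%N. Proof. by apply: leq_trans K3. Qed.

Lemma coef1M a b : (a * b)`_1 = a`_0 * b`_1 + a`_1 * b`_0.
Proof. by rewrite coefM !big_ord_recl big_ord0 addr0. Qed.

Lemma coef2M a b : (a * b)`_2 = a`_0 * b`_2 + a`_1 * b`_1 + a`_2 * b`_0.
Proof. by rewrite coefM !big_ord_recl big_ord0 addr0 addrA. Qed.

(* For s t = 2 the matrix N = S T_s S T_t has trace zero at h = 0, and in fact
   modulo h^2; by Cayley-Hamilton N^2 = tr(N) N - det(N). *)
Lemma graded2 : exists2 k, k != 0 & graded (F := F) K 2 (k * - 2) (k * - 2^-1) (k * 4).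
Proof.
(* When s t = 2, the coefficient of h^2 in the trace is (5 - s^2 - t^2)/6. It vanishes for every
   integral pair, namely (1, 2) up to order and sign; for the present pair it equals -15/8. *)
pose s : F := 4; pose t : F := 2^-1.
have hS := stab_S (F := F) K0.
have h := stab_mul (stab_mul (F := F) hS (stab_T K0 s)) (stab_mul hS (stab_T K0 t)).
have {h hS} := stab_mul h h.
have eE (r : F) : ((texp K r)`_0 = 1) * ((texp K r)`_1 = r) * ((texp K r)`_2 = r ^+ 2 / 2).
  have K2 : (2 <= K)%N by apply: leq_trans K3.
  by rewrite !coef_poly !ltnS K2 (ltnW K2) /= expr0 !divr1.
have wE (r : F) :
    ((tquot K r)`_0 = r) * ((tquot K r)`_1 = r ^+ 2 / 2) * ((tquot K r)`_2 = r ^+ 3 / 6).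
  by rewrite !coef_poly K3 (ltnW K3) K0 /= divr1.
have cE := (coefD, coefN, coef0M, coef1M, coef2M).
set q := texp K 1; set v := tquot K 1; set es := texp K s; set et := texp K t.
set ws := tquot K s; set wt := tquot K t.
pose a : {poly F} := - (q * et * v ^+ 2); pose b : {poly F} := - (q * v * wt).
pose c : {poly F} := q ^+ 2 * ws * et * v.
pose d : {poly F} := - (q * es * v ^+ 2) + q ^+ 2 * ws * wt.
pose tau : {poly F} := a + d.
have [k k0 [tau' tau2 tauE]] : exists2 k : F, k != 0 &
    exists2 tau' : {poly F}, tau'`_0 = k & tau = 'X^2 * tau'.
  have t0 : tau`_0 = 0.
    rewrite /tau /a /d !expr2 !cE /q /v /es /et /ws /wt !eE !wE /s /t /=.
    by field.
  have t1 : tau`_1 = 0.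
    rewrite /tau /a /d !expr2 !cE /q /v /es /et /ws /wt !eE !wE /s /t /=.
    by field.
  have t2 : tau`_2 = - (15 / 8).
    rewrite /tau /a /d !expr2 !cE /q /v /es /et /ws /wt !eE !wE /s /t /=.
    by field.
  exists tau`_2; first by rewrite t2 oppr_eq0 mulf_neq0 ?invr_eq0 ?pnatr_eq0.
  exists (drop_poly 2 tau); first by rewrite coef_drop_poly.
  rewrite -{1}(poly_take_drop 2 tau) mulrC.
  suff -> : take_poly 2 tau = 0 by rewrite add0r.
  apply/polyP => i; rewrite coef_take_poly coef0.
  by case: i => [|[|i]].
rewrite /graded => h; exists k => //.
exists (tau' * (a - d)), (tau' * b), (tau' * c), (tau * d - (a * d - b * c)).
have q0 : q`_0 = 1 by exact: texp_coef0.
have v0 : v`_0 = 1 by exact: tquot_coef0.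
have es0 : es`_0 = 1 by exact: texp_coef0.
have et0 : et`_0 = 1 by exact: texp_coef0.
have ws0 : ws`_0 = 4 by exact: tquot_coef0.
have wt0 : wt`_0 = 2^-1 by exact: tquot_coef0.
have two0 : 2 != 0 :> F by rewrite pnatr_eq0.
split.
- have tauM r : 'X^2 * (tau' * r) = tau * r by rewrite tauE mulrA.
  by apply: stab_ext h; rewrite ?tauM /tau /a /b /c /d; ring.
- have tau0 : tau`_0 = 0 by rewrite tauE coef0M coefXn mul0r.
  rewrite coefB coef0M tau0 mul0r sub0r oppr_eq0.
  rewrite /a /b /c /d !expr2 !(coefD, coefN, coef0M) q0 v0 es0 et0 ws0 wt0.
  set D := (X in X != 0); have -> : D = 1 by rewrite /D; field.
  exact: oner_neq0.
- rewrite /a /d coef0M tau2 !expr2 !(coefD, coefN, coef0M) q0 v0 es0 et0 ws0 wt0.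
  by field.
- by rewrite /b coef0M tau2 !(coefN, coef0M) q0 v0 wt0; ring.
- by rewrite /c coef0M tau2 !expr2 !coef0M q0 v0 et0 ws0; ring.
Qed.

Lemma graded_even n : exists x y z : F,
  [|| x != 0, y != 0 | z != 0] /\ graded K (2 * n.+1) x y z.
Proof.
have two0 : 2 != 0 :> F by rewrite pnatr_eq0.
have four0 : 4 != 0 :> F by rewrite pnatr_eq0.
have [k k0 g] := graded2.
elim: n => [|n [x [y [z [v0 gn]]]]].
  exists (k * - 2), (k * - 2^-1), (k * 4); split; last by rewrite muln1.
  by rewrite orbA orbC mulf_neq0.
(* g and its conjugate g' have nonparallel directions, so gn commutes with at most one. *)
have g' := graded_conj K0 1 (isT : 0 < 2)%N g.
rewrite mulnS.
have [l l0 h] := graded_comm (isT : 0 < 2)%N (isT : 0 < 2 * n.+1)%N g gn.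
have [l' l'0 h'] := graded_comm (isT : 0 < 2)%N (isT : 0 < 2 * n.+1)%N g' gn.
move: h h'; set a := k * - 2; set b := k * - 2^-1; set c := k * 4 => h h'.
have c0 : c != 0 by rewrite /c mulf_neq0.
clearbody a b c; have [e|e] := boolP [|| l * (2 * (b * z - y * c)) != 0, l * (a * y - x * b) != 0
                       | l * (c * x - z * a) != 0].
  by do 3 eexists; split; first exact: e.
do 3 eexists; split; last exact: h'.
(* If both brackets vanish, their third components give c x = a z and c x = (a + 2 c) z, so z = 0;
   then x = 0 and y = 0 because c is nonzero. *)
apply: contraTT v0 => e'; move: e e'.
rewrite !negb_or !negbK !mulf_eq0 (negPf l0) (negPf l'0) (negPf two0) /= !subr_eq0.
move=> /and3P[/eqP e1 _ /eqP e3] /and3P[_ _ /eqP e3'].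
have z0 : z = 0.
  have /eqP : 2 * c * z = 0.
    by move/eqP: e3'; rewrite e3 eq_sym -subr_eq0 => /eqP <-; ring.
  by rewrite !mulf_eq0 (negPf two0) (negPf c0) => /eqP.
move/eqP: e3; rewrite z0 mul0r mulf_eq0 (negPf c0) /= => ->.
move/esym/eqP: e1; rewrite z0 mulr0 mulf_eq0 (negPf c0) orbF => ->.
by rewrite eqxx.
Qed.

(* x g + y - z g^2 is the vector field on the projective line defined by [[x, y], [z, 0]]. *)
Lemma graded_move n g0 : exists x y z : F,
  x * g0 + y - z * g0 ^+ 2 != 0 /\ graded K (2 * n.+1) x y z.
Proof.
have [x [y [z [v0 h]]]] := graded_even n.
(* [f s] is the value of the original vector field at the translated point [g0 - s]. A polynomial of
   degree at most 2 that vanishes at 0, -1 and 1 is zero, so one of three translations works. *)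
pose f s : F := (x + 2 * s * z) * g0 + (y - s * x - s ^+ 2 * z) - z * g0 ^+ 2.
suff [s fs] : exists s, f s != 0.
  by do 3 eexists; split; last apply: (graded_conj K0 s (isT : 0 < 2 * n.+1)%N h).
have [f0|] := eqVneq (f g0) 0; last by exists g0.
have [f1|] := eqVneq (f (g0 + 1)) 0; last by exists (g0 + 1).
have [f2|] := eqVneq (f (g0 - 1)) 0; last by exists (g0 - 1).
exfalso; move: v0; apply/negP; rewrite !negb_or !negbK.
have y0 : y = 0 by rewrite -f0 /f; ring.
have /eqP : - (2 * z) = 0 by rewrite -[RHS](addr0 0) -{1}f1 -f2 /f y0; ring.
have /eqP : 2 * x = 0 by rewrite -[RHS](subr0 0) -{1}f2 -f1 /f y0; ring.
have two0 : 2 != 0 :> F by rewrite pnatr_eq0.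
by rewrite oppr_eq0 !mulf_eq0 (negPf two0) y0 eqxx /= => -> ->.
Qed.
End Directions.

(** * Zariski density of the even jets *)

Section RationalDependence.
Variable F : numFieldType.
Implicit Types (f g b : F -> F) (s : F).

Definition polyfun f := exists p : {poly F}, forall s, f s = p.[s].

Lemma polyfun_cst c : polyfun (fun=> c).
Proof. by exists c%:P => s; rewrite hornerC. Qed.

Lemma polyfun_id : polyfun id.
Proof. by exists 'X => s; rewrite hornerX. Qed.

Lemma polyfunD f g : polyfun f -> polyfun g -> polyfun (fun s => f s + g s).
Proof. by move=> [p fp] [q gq]; exists (p + q) => s; rewrite hornerD fp gq. Qed.

Lemma polyfunM f g : polyfun f -> polyfun g -> polyfun (fun s => f s * g s).
Proof. by move=> [p fp] [q gq]; exists (p * q) => s; rewrite hornerM fp gq. Qed.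

Lemma polyfunX f n : polyfun f -> polyfun (fun s => f s ^+ n).
Proof. by move=> [p fp]; exists (p ^+ n) => s; rewrite horner_exp fp. Qed.

Lemma polyfun_sum n (f : 'I_n -> F -> F) :
  (forall i, polyfun (f i)) -> polyfun (fun s => \sum_i f i s).
Proof.
move=> /choice [p fp]; exists (\sum_i p i) => s.
by rewrite horner_sum; apply: eq_bigr.
Qed.

Definition coefpoly (u : F -> {poly F}) := forall k, polyfun (fun s => (u s)`_k).

Lemma coefpoly_cst a : coefpoly (fun=> a).
Proof. by move=> k; apply: polyfun_cst. Qed.

Lemma coefpolyD u v : coefpoly u -> coefpoly v -> coefpoly (fun s => u s + v s).
Proof.
move=> hu hv k; have [p e] := polyfunD (hu k) (hv k).
by exists p => s; rewrite coefD e.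
Qed.

Lemma coefpolyM u v : coefpoly u -> coefpoly v -> coefpoly (fun s => u s * v s).
Proof.
move=> hu hv k.
have [p e] := polyfun_sum (fun i : 'I_k.+1 => polyfunM (hu i) (hv (k - i)%N)).
by exists p => s; rewrite coefM e.
Qed.

Lemma coefpolyN u : coefpoly u -> coefpoly (fun s => - u s).
Proof.
move=> hu k; have [p e] := polyfunM (polyfun_cst (-1)) (hu k).
by exists p => s; rewrite coefN -mulN1r e.
Qed.

Lemma coefpoly_poly n (c : nat -> F -> F) :
  (forall k, polyfun (c k)) -> coefpoly (fun s => \poly_(k < n) c k s).
Proof.
move=> hc k; have [p e] : polyfun (fun s => if (k < n)%N then c k s else 0).
  by case: (k < n)%N; [exact: (hc k) | exact: polyfun_cst].
by exists p => s; rewrite coef_poly e.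
Qed.

Lemma coefpoly_texp K : coefpoly (texp K).
Proof.
apply: coefpoly_poly => k; apply: polyfunM (polyfun_cst _).
exact: polyfunX polyfun_id.
Qed.

Lemma coefpoly_tquot K : coefpoly (tquot K).
Proof.
apply: coefpoly_poly => k; apply: polyfunM (polyfun_cst _).
exact: polyfunX polyfun_id.
Qed.

Lemma coefpoly_qword K l1 l2 :
  coefpoly (fun s => (qword K (l1 ++ s :: l2)).1) /\
  coefpoly (fun s => (qword K (l1 ++ s :: l2)).2).
Proof.
elim: l1 => [|t l1 [IH1 IH2]] /=; split.
- apply: coefpolyD; last exact: coefpolyM (coefpoly_tquot K) (coefpoly_cst _).
  apply: coefpolyM (coefpoly_cst _).
  exact: coefpolyM (coefpoly_texp K) (coefpoly_cst _).
- exact: coefpoly_cst.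
- apply: coefpolyD; apply: coefpolyM (coefpoly_cst _) _; first exact: coefpolyN.
  exact: coefpolyM (coefpoly_cst _) _.
- by apply: coefpolyM (coefpoly_cst _) _; apply: coefpolyM (coefpoly_cst _) _.
Qed.

(** A rational function whose denominator is a power of [b]. Its values at the zeros of [b] are left
    free, so quotients may take arbitrary values there. *)
Definition ratfun b f := exists n (p : {poly F}), forall s, b s != 0 -> b s ^+ n * f s = p.[s].

Variable b : F -> F.
Hypothesis hb : polyfun b.

Lemma ratfun_poly f : polyfun f -> ratfun b f.
Proof. by move=> [p fp]; exists 0%N, p => s _; rewrite mul1r. Qed.

Lemma ratfunM f g : ratfun b f -> ratfun b g -> ratfun b (fun s => f s * g s).
Proof.
move=> [m [p fp]] [n [q gq]]; exists (m + n)%N, (p * q) => s bs.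
by rewrite hornerM -fp // -gq // exprD mulrACA.
Qed.

Lemma ratfunD f g : ratfun b f -> ratfun b g -> ratfun b (fun s => f s + g s).
Proof.
have [d bd] := hb.
move=> [m [p fp]] [n [q gq]]; exists (m + n)%N, (d ^+ n * p + d ^+ m * q) => s bs.
by rewrite hornerD !hornerM !horner_exp -!bd -fp // -gq // exprD; ring.
Qed.

Lemma ratfun_sum (I : Type) (r : seq I) (Q : pred I) (f : I -> F -> F) :
  (forall i, Q i -> ratfun b (f i)) -> ratfun b (fun s => \sum_(i <- r | Q i) f i s).
Proof.
move=> hf; elim: r => [|i r [n [p e]]].
  by apply: ratfun_poly; exists 0 => s; rewrite big_nil horner0.
have [Qi|nQi] := boolP (Q i); last first.
  by exists n, p => s /e; rewrite big_cons (negPf nQi).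
have [n' [p' e']] := ratfunD (hf _ Qi) (ex_intro _ n (ex_intro _ p e)).
by exists n', p' => s /e'; rewrite big_cons Qi.
Qed.

Lemma ratfun_prod (I : Type) (r : seq I) (f : I -> F -> F) :
  (forall i, ratfun b (f i)) -> ratfun b (fun s => \prod_(i <- r) f i s).
Proof.
move=> hf; elim: r => [|i r [n [p e]]].
  by apply: ratfun_poly; exists 1 => s; rewrite big_nil hornerC.
have [n' [p' e']] := ratfunM (hf i) (ex_intro _ n (ex_intro _ p e)).
by exists n', p' => s /e'; rewrite big_cons.
Qed.

Lemma ratfunX f n : ratfun b f -> ratfun b (fun s => f s ^+ n).
Proof.
move=> [m [p e]]; exists (m * n)%N, (p ^+ n) => s /e; rewrite horner_exp => <-.
by rewrite exprMn exprM.
Qed.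

Lemma ratfun_div f g : ratfun b g -> (forall s, b s != 0 -> b s * f s = g s) -> ratfun b f.
Proof.
move=> [n [p e]] h; exists n.+1, p => s bs.
by rewrite exprSr -mulrA h // e.
Qed.

Lemma ratfun_meval N (P : mpoly N F) (t : F -> 'I_N -> F) :
  (forall i, ratfun b (t^~ i)) -> ratfun b (fun s => meval (t s) P).
Proof.
move=> ht.
have := @ratfun_sum _ (msupp P) xpredT
   (fun m s => mcoeff m P * \prod_i t s i ^+ m i).
case=> [m _|n [p e]]; last by exists n, p => s /e <-; rewrite mevalE.
apply: ratfunM; first exact/ratfun_poly/polyfun_cst.
by apply: ratfun_prod => i; apply: ratfunX.
Qed.

(** The numerator times [b] is a polynomial vanishing at every natural number: because of [f] where
    [b] is nonzero, because of the extra factor elsewhere. *)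
Lemma ratfun_eq0 f s : ratfun b f -> (forall n : nat, b n%:R != 0 -> f n%:R = 0) ->
  b s != 0 -> f s = 0.
Proof.
move=> [n [p e]] f0 bs; have [d bd] := hb.
have /eqP : d * p = 0.
  apply: (@poly_infinite_roots _ _ (fun n => n%:R)) => [k k' /eqP|k].
    by rewrite eqr_nat => /eqP.
  rewrite hornerM -bd; have [->|bk] := eqVneq (b k%:R) 0; first by rewrite mul0r.
  by rewrite -e // f0 // !mulr0.
rewrite mulf_eq0 => /orP[/eqP d0|/eqP p0]; first by rewrite bd d0 horner0 eqxx in bs.
have := e _ bs; rewrite p0 horner0 => /eqP.
by rewrite mulf_eq0 expf_eq0 (negPf bs) andbF => /eqP.
Qed.

End RationalDependence.

(** * Passage from integral exponents to the whole group, and density of the jets *)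

Section Density.
Variables (F : numFieldType) (K N : nat) (P : mpoly N F).
Hypotheses (K3 : (3 <= K)%N) (NK : (2 * N <= K)%N).
Implicit Types (p r g c : {poly F}).

Let K0 : (0 < K)%N. Proof. by apply: leq_trans K3. Qed.

Definition even_derivatives g (i : 'I_N) : F := (2 * i)`!%:R * g`_(2 * i).

(** Here [g] is the expansion of p / r, determined modulo ['X^K] when the point is finite at h = 0;
    points at infinity impose no condition. *)
Definition vanishes p r := r`_0 != 0 -> forall g, eqmodX K (g * r) p ->
  meval (even_derivatives g) P = 0.

Lemma vanishes_scale c p r p' r' : c`_0 != 0 ->
  eqmodX K p (c * p') -> eqmodX K r (c * r') -> vanishes p' r' -> vanishes p r.
Proof.
move=> c0 ep er h r0 g eg; apply: h; last first.
  apply: (eqmodXI c0); rewrite mulrCA; apply: eqmodX_trans ep.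
  by apply: eqmodX_trans eg; apply/eqmodXMl/eqmodX_sym.
by move: r0; rewrite (eqmodX_coef0 K0 er) coef0M mulf_eq0 (negPf c0).
Qed.

(* The Taylor coefficients depend rationally on each exponent of the word, so
   a polynomial relation on integer exponents extends to all exponents. *)
Lemma vanishes_param l1 l2 :
  (forall n : nat, vanishes (qword K (l1 ++ n%:R :: l2)).1 (qword K (l1 ++ n%:R :: l2)).2) ->
  forall s, vanishes (qword K (l1 ++ s :: l2)).1 (qword K (l1 ++ s :: l2)).2.
Proof.
have [] := coefpoly_qword K l1 l2.
set p := fun s => _; set r := fun s => _ => hp hr h s; rewrite -/(p s) -/(r s) => r0 g eg.
have hb : polyfun (fun s => (r s)`_0) by exact: hr.
have /choice [G hG] : forall t, exists x, (r t)`_0 != 0 -> eqmodX K (x * r t) (p t).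
  move=> t; have [rt|rt] := boolP ((r t)`_0 != 0); last by exists 0.
  by have [x hx] := eqmodX_div K (p t) rt; exists x.
(* The equation G r = p is triangular: its coefficient of degree k expresses [G_k] times [r_0]
   through [p_k] and the earlier [G_i]. Hence only powers of [r_0] appear in denominators. *)
have rG k : (k < K)%N -> ratfun (fun s => (r s)`_0) (fun s => (G s)`_k).
  elim/ltn_ind: k => k IH kK.
  apply: (@ratfun_div _ _ _ (fun s => (p s)`_k +
      \sum_(i < k) (- 1) * ((G s)`_i * (r s)`_(k - i)))).
    apply: ratfunD => //; first exact/ratfun_poly/hp.
    apply: ratfun_sum => // i _; apply: ratfunM; first exact/ratfun_poly/polyfun_cst.
    apply: ratfunM; first by apply: IH => //; apply: ltn_trans kK.
    exact/ratfun_poly/hr.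
  move=> t /hG /eqmodXP /(_ k kK) <-; rewrite coefM big_ord_recr subnn /= -mulr_sumr.
  by ring.
have /eqmodXP egG : eqmodX K g (G s).
  apply: (eqmodXI r0); rewrite !(mulrC (r s)).
  by apply: eqmodX_trans eg _; apply/eqmodX_sym/hG.
have iK (i : 'I_N) : (2 * i < K)%N by apply: leq_trans NK; rewrite ltn_pmul2l.
rewrite (@meval_eq _ _ _ (even_derivatives (G s))); last first.
  by move=> i; rewrite /even_derivatives egG.
apply: (ratfun_eq0 hb (f := fun s => meval (even_derivatives (G s)) P)) => //.
  apply: (ratfun_meval hb) => i; apply: ratfunM; last exact: rG.
  exact/ratfun_poly/polyfun_cst.
by move=> n rn; exact: (h n rn _ (hG _ rn)).
Qed.

(** Exponents are freed one at a time. The prefix is arbitrary and the suffix integral; the last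
    exponent of the prefix may be assumed integral by [vanishes_param], and then joins the
    suffix. *)
Lemma vanishes_qword :
  (forall l : seq nat, vanishes (qword K (map (fun n => n%:R) l)).1
                                (qword K (map (fun n => n%:R) l)).2) ->
  forall l, vanishes (qword K l).1 (qword K l).2.
Proof.
move=> h l; rewrite -[l]cats0.
suff: forall l' : seq nat, vanishes (qword K (l ++ map (fun n => n%:R) l')).1
                             (qword K (l ++ map (fun n => n%:R) l')).2.
  by move/(_ [::]).
elim/last_ind: l => [//|l s IH] l'; rewrite cat_rcons.
by apply: vanishes_param => n; apply: (IH (n :: l')).
Qed.

Lemma eqmodX_lowest m a r w : (m < K)%N -> r`_0 != 0 -> eqmodX K (a * r) ('X^m * w) ->
  (forall k, (k < m)%N -> a`_k = 0) /\ a`_m * r`_0 = w`_0.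
Proof.
move=> mK r0 h; have [c ac] : eqmodX m a 0.
  apply: (eqmodXI r0); rewrite mulr0 mulrC.
  apply: eqmodX_trans (eqmodX_le (ltnW mK) h) _.
  by exists w; rewrite add0r mulrC.
rewrite ac add0r; split=> [k km|]; first by rewrite coefMXn km.
move/eqmodXP/(_ m mK): h; rewrite ac add0r mulrAC (mulrC _ w) !coefMXn ltnn subnn.
by rewrite coef0M.
Qed.

(** For j > 0, an element that is scalar modulo ['X^(2 * j)] is applied n times. Each application
    adds the same [k], since [k] depends only on the constant term of [g], which is preserved. *)
Lemma qorbit_move j p r g : (2 * j < K)%N -> qorbit K p r -> r`_0 != 0 ->
  eqmodX K (g * r) p -> exists2 k, k != 0 & forall n : nat, exists p' r' g',
  [/\ qorbit K p' r', r'`_0 != 0, eqmodX K (g' * r') p',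
      forall i, (i < 2 * j)%N -> g'`_i = g`_i & g'`_(2 * j) = g`_(2 * j) + n%:R * k].
Proof.
case: j => [_|j jK] o r0 eg.
  (* T_n adds n to the constant term, and there is no lower coefficient to preserve. *)
  exists 1; rewrite ?oner_neq0 // => n.
  have o' := qorbit_T K0 n%:R o.
  have r'0 : (tquot K 1 * r)`_0 != 0 by rewrite coef0M mulf_neq0 ?tquot1_coef0.
  have [g' eg'] := eqmodX_div K (texp K n%:R * tquot K 1 * p + tquot K n%:R * r) r'0.
  do 3 eexists; split; [exact: o' | exact: r'0 | exact: eg' | by [] |].
  move: (eqmodX_coef0 K0 eg') (eqmodX_coef0 K0 eg); rewrite muln0.
  rewrite coefD !coef0M texp_coef0 !tquot_coef0 // !mul1r => e' ep.
  by apply: (mulIf r0); rewrite e' -ep; ring.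
have [x [y [z [xi0 [a [b [c [d [h d0 ea eb ec]]]]]]]]] := graded_move K3 j g`_0.
set m := (2 * j.+1)%N in h jK *.
pose k := (x * g`_0 + y - z * g`_0 ^+ 2) / d`_0.
exists k; first by rewrite mulf_neq0 ?invr_eq0.
elim=> [|n [p' [r' [g' [ho r'0 eg' glow gm]]]]].
  by exists p, r, g; split => //; rewrite mul0r addr0.
have [{}ho _] := h _ _ ho.
have X0 : ('X^m : {poly F})`_0 = 0 by rewrite coefXn.
have r''0 : ('X^m * c * p' + d * r')`_0 != 0.
  by rewrite coefD !coef0M X0 !mul0r add0r mulf_neq0.
have [g'' eg''] := eqmodX_div K ((d + 'X^m * a) * p' + 'X^m * b * r') r''0.
(* With u = ['X^m], the matrix [[d + u a, u b], [u c, d]] moves g' by u (a g' + b - c g'^2) / (d + u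
   c g'); the new denominator is r' (d + u c g'). *)
have := @eqmodX_lowest m (g'' - g') _ (r' * (a * g' + b - c * g' ^+ 2)) jK r''0.
case=> [|low mid].
  case: eg' => e ep; case: eg'' => f ef; rewrite mulrBl ef.
  have {ep} -> : p' = g' * r' - e * 'X^K by rewrite ep addrK.
  set u := 'X^m; set w := 'X^K.
  by exists (f - e * (d + u * a) + g' * u * c * e); rewrite -/w; ring.
do 3 eexists; split; [exact: ho | exact: r''0 | exact: eg'' | |].
  by move=> i im; rewrite -glow //; apply/eqP; rewrite -subr_eq0 -coefB low.
have g'0 : g'`_0 = g`_0 by exact: glow.
have -> : g''`_m = g'`_m + (g'' - g')`_m by rewrite coefB addrC subrK.
rewrite gm -addrA; congr (_ + _); rewrite -natr1 mulrDl mul1r; congr (_ + _).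
apply: (mulIf r''0); rewrite mid coefD !coef0M X0 !mul0r add0r.
rewrite expr2 coefB coefD !coef0M ea eb ec g'0 /k.
by field.
Qed.

Lemma vanishes_eq0 : (forall p r, qorbit K p r -> vanishes p r) -> P = 0.
Proof.
move=> hP.
(* [D j]: [P] vanishes as soon as the first [j] coordinates come from a point of the orbit, the
   others being arbitrary. The induction descends from [D N] to [D 0]. *)
pose D j := forall p r g (t : 'I_N -> F), qorbit K p r -> r`_0 != 0 ->
   eqmodX K (g * r) p -> (forall i : 'I_N, (i < j)%N -> t i = even_derivatives g i) ->
   meval t P = 0.
have DN : D N.
  move=> p r g t o r0 eg et; rewrite (@meval_eq _ _ _ (even_derivatives g)).
    exact: hP eg.
  by move=> i; apply: et.
(* On a line parallel to a coordinate axis, infinitely many zeros of [P] force it to vanish on the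
   whole line. *)
have fibre (i : 'I_N) t (u : nat -> F) : injective u ->
    (forall n, meval (fun j => if j == i then u n else t j) P = 0) -> meval t P = 0.
  move=> inju h; have [q hq] := meval_line P i t.
  have q0 : q = 0 by apply: (poly_infinite_roots inju) => n; rewrite -hq.
  rewrite (@meval_eq _ _ _ (fun j => if j == i then t i else t j)).
    by rewrite hq q0 horner0.
  by move=> j; case: eqP => [->|].
have DS j : D j.+1 -> D j.
  move=> Dj p r g t o r0 eg et.
  have [jN|jN] := ltnP j N; last first.
    by apply: (Dj p r g t) => // i _; apply: et; apply: leq_trans jN.
  have jK : (2 * j < K)%N by apply: leq_trans NK; rewrite ltn_pmul2l.
  have [k k0 hk] := qorbit_move jK o r0 eg.
  have f0 : (2 * j)`!%:R != 0 :> F by rewrite pnatr_eq0 -lt0n fact_gt0.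
  apply: (fibre (Ordinal jN) t (fun n => (2 * j)`!%:R * (g`_(2 * j) + n%:R * k))).
    by move=> n n' /(mulfI f0) /addrI /(mulIf k0) /eqP; rewrite eqr_nat => /eqP.
  move=> n; have [p' [r' [g' [ho r'0 eg' low mid]]]] := hk n.
  apply: (Dj p' r' g') => // i; rewrite ltnS leq_eqVlt => /orP[/eqP ij|ij].
    by rewrite -val_eqE /= ij eqxx /even_derivatives ij mid.
  rewrite -val_eqE /= ltn_eqF // et // /even_derivatives low //.
  by rewrite ltn_pmul2l.
have {DN} : D 0%N by move: DN; elim: {1}N => // n IH /DS.
(* [D 0] puts no condition on [t], so the single point 0, given by the empty word, suffices. *)
move=> D0; apply: mpoly_fun_eq0 => t; apply: (D0 0 1 0 t) => //.
- exists [::], 1; rewrite coef1 oner_neq0; split => //=.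
    by rewrite mulr0; apply: eqmodX_refl.
  by rewrite mulr1; apply: eqmodX_refl.
- by rewrite coef1 oner_neq0.
- by rewrite mul0r; apply: eqmodX_refl.
Qed.

Theorem algebraic_density :
  (forall l : seq nat, vanishes (qword K (map (fun n => n%:R) l)).1
                                (qword K (map (fun n => n%:R) l)).2) -> P = 0.
Proof.
move=> h; apply: vanishes_eq0 => p r [l [c [c0 ep er]]].
by apply: (vanishes_scale c0 ep er); apply: vanishes_qword.
Qed.

End Density.

(** * Taylor expansion of q-rationals *)

(* (a : b) are homogeneous coordinates of [x]_q specialising to x at q = 1. *)
Definition lifts (x : P1 rat) (a b : {poly rat}) :=
  [/\ col2 a.[1] b.[1] != 0, P1_of (col2 a.[1] b.[1]) = x &
      P1_of (col2 (tofrac a) (tofrac b)) = qrat x].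

Section Lifts.
Implicit Types (x : P1 rat) (a b : {poly rat}).

Lemma tofrac_col2_neq0 a b : col2 a.[1] b.[1] != 0 -> col2 (tofrac a) (tofrac b) != 0.
Proof.
rewrite !col2_eq0 !tofrac_eq0; apply: contra.
by move=> /andP[/eqP -> /eqP ->]; rewrite horner0 eqxx.
Qed.

Lemma lifts_0 : lifts (Some 0) 0 1.
Proof.
have [q0 _ _] := qratP; split.
- by rewrite !hornerE col2_eq0 oner_eq0 andbF.
- by rewrite !hornerE point_col2 oner_eq0 mul0r.
by rewrite q0 point_col2 tofrac0 tofrac1 oner_eq0 mul0r.
Qed.

Lemma lifts_T x a b : lifts x a b -> lifts (qshift 1 x) ('X * a + b) b.
Proof.
have [_ qT _] := qratP; case=> n e1 e2; split.
- move: n; rewrite !hornerE !col2_eq0; apply: contra => /andP[h /eqP hb].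
  by move: h; rewrite hb addr0 => ->; rewrite eqxx.
- by rewrite !hornerE -e1 qshift_col2 mul1r.
by rewrite qT -e2 qshift_col2 tofracD tofracM.
Qed.

Lemma lifts_TV x a b : lifts (qshift 1 x) a b -> lifts x (a - b) ('X * b).
Proof.
have [_ qT _] := qratP; case=> n e1 e2; split.
- move: n; rewrite !hornerE !col2_eq0; apply: contra => /andP[h /eqP hb].
  by move: h; rewrite hb subr0 => ->; rewrite eqxx.
- apply: (can_inj (qshiftK (oner_neq0 _))).
  by rewrite !hornerE qshift_col2 -e1 mul1r subrK.
apply: (can_inj (qshiftK qvar_neq0)).
rewrite qshift_col2 -qT -e2 tofracB tofracM -mulrDr subrK.
by rewrite point_scale ?qvar_neq0.
Qed.

Lemma lifts_S x a b : lifts x a b -> lifts (qneginv 1 x) (- b) ('X * a).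
Proof.
have [_ _ qS] := qratP; case=> n e1 e2; split.
- by move: n; rewrite !hornerE !col2_eq0 oppr_eq0 andbC.
- by rewrite !hornerE -e1 qneginv_col2 ?oner_neq0 // mul1r.
by rewrite qS -e2 (qneginv_col2 qvar_neq0 (tofrac_col2_neq0 n)) tofracN tofracM.
Qed.

Lemma lifts_opp x a b : lifts x a b -> lifts x (- a) (- b).
Proof.
have e (L : fieldType) (u v : L) : P1_of (col2 (- u) (- v)) = P1_of (col2 u v).
  by rewrite -(mulN1r u) -(mulN1r v) point_scale // oppr_eq0 oner_neq0.
case=> n e1 e2; split; last by rewrite !tofracN e.
  by move: n; rewrite !hornerE !col2_eq0 !oppr_eq0.
by rewrite !hornerE e.
Qed.

End Lifts.

(** * Derivatives at h = 0 of rational functions of exp h *)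

Section TaylorExpansion.
Variable R : realType.
Implicit Types (p d : {poly rat}) (h : R).

Definition qfrac p d h := (map_poly (@ratr R) p).[expR h] / (map_poly (@ratr R) d).[expR h].

Lemma near0_qden d : d.[1] != 0 -> \forall h \near (0 : R), (map_poly (@ratr R) d).[expR h] != 0.
Proof.
move=> d1; have d0 : (map_poly (@ratr R) d).[expR (0 : R)] != 0.
  by rewrite expR0 -(rmorph1 (@ratr R)) horner_map fmorph_eq0.
have : ((fun h : R => (map_poly (@ratr R) d).[expR h]) @ (0 : R) -->
    (map_poly (@ratr R) d).[expR (0 : R)])%classic.
  apply: (@continuous_comp _ _ _ expR (horner (map_poly (@ratr R) d))).
    exact: continuous_expR.
  exact: continuous_horner.
by move/cvgr_neq0; apply.
Qed.

(** For q = exp h the derivative d/dh is q d/dq, so derivatives remain fractions in q, with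
    denominator a power of the original one. *)
Lemma is_derive_qfrac p d h : (map_poly (@ratr R) d).[expR h] != 0 ->
  is_derive h 1 (qfrac p d) (qfrac ('X * (p^`() * d - p * d^`())) (d ^+ 2) h).
Proof.
move=> dh; set P := map_poly (@ratr R) p; set D := map_poly (@ratr R) d in dh *.
have hh (A : {poly R}) : is_derive h 1 (horner A \o expR) (A^`().[expR h] * expR h).
  have D1 : is_derive (expR h) 1 (horner A) A^`().[expR h].
    by rewrite derivE derive1E; apply: DeriveDef; [exact: (@derivable_horner _ A)|].
  exact: is_derive1_comp.
have hV := is_deriveV (f := horner D \o expR) dh (hh D).
have := is_deriveM (hh P) hV.
move/is_derive_eq; apply.
rewrite /qfrac !(rmorphM, rmorphB, rmorphXn) /= !deriv_map map_polyX -/P -/D.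
by rewrite !hornerE /GRing.scale /=; field.
Qed.

Lemma near_derive1n n (f g : R -> R) (a : R) : (\forall h \near a, f h = g h) ->
  \forall h \near a, derive1n n f h = derive1n n g h.
Proof.
elim: n f g => // n IH f g fg; rewrite !derive1Sn; apply: IH.
move/near_join: fg; apply: filterS => h fg.
by rewrite !derive1E; apply: near_eq_derive.
Qed.

Lemma near_derive1_qfrac p d : d.[1] != 0 -> \forall h \near (0 : R),
  (derive1 (qfrac p d)) h = qfrac ('X * (p^`() * d - p * d^`())) (d ^+ 2) h.
Proof.
move/near0_qden; apply: filterS => h /(is_derive_qfrac p) D.
by rewrite derive1E derive_val.
Qed.

(** Supplies differentiability at every order: near 0, each iterated derivative is again a fraction
    regular at q = 1. *)
Lemma near_derive1n_qfrac n p d : d.[1] != 0 -> exists p' d', d'.[1] != 0 /\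
  \forall h \near (0 : R), derive1n n (qfrac p d) h = qfrac p' d' h.
Proof.
elim: n p d => [|n IH] p d d1.
  by exists p, d; split=> //; near=> h; exact: erefl.
have [|p' [d' [d'1 e]]] := IH ('X * (p^`() * d - p * d^`())) (d ^+ 2).
  by rewrite horner_exp expf_neq0.
exists p', d'; split=> //; rewrite derive1Sn.
apply: filterS2 e (near_derive1n n (near_derive1_qfrac p d1)) => h e1 e2.
by rewrite e2.
Unshelve. all: by end_near. Qed.

(** Each differentiation contributes one sign by the chain rule. The identity is asserted on a
    neighbourhood of 0 so that it can be differentiated again. *)
Lemma derive1n_qfracN n p d : d.[1] != 0 -> \forall h \near (0 : R),
  derive1n n (fun h => qfrac p d (- h)) h = (-1) ^+ n * derive1n n (qfrac p d) (- h).
Proof.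
move=> d1; elim: n => [|n IH]; first by near=> h; rewrite mul1r.
have [p' [d' [d'1 e]]] := near_derive1n_qfrac n p d1.
have cN : ((fun h : R => - h) @ (0 : R) --> (0 : R))%classic.
  by rewrite -[X in (_ --> X)%classic]oppr0; exact: oppr_continuous.
have eN : \forall h \near (0 : R), \forall k \near h,
    derive1n n (qfrac p d) (- k) = qfrac p' d' (- k).
  by apply: near_join; exact: cN e.
have dN : \forall h \near (0 : R), (map_poly (@ratr R) d').[expR (- h)] != 0.
  exact: cN (near0_qden d'1).
have eN' : \forall h \near (0 : R), \forall k \near - h,
    derive1n n (qfrac p d) k = qfrac p' d' k.
  exact: cN (near_join e).
move/near_join: IH => IH.
near=> h.
rewrite !derive1nS !derive1E.
have e1 : \forall k \near h, derive1n n (fun h => qfrac p d (- h)) k =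
    (-1) ^+ n * qfrac p' d' (- k).
  have h1 : \forall k \near h, derive1n n (fun h => qfrac p d (- h)) k =
     (-1) ^+ n * derive1n n (qfrac p d) (- k) by near: h.
  have h2 : \forall k \near h, derive1n n (qfrac p d) (- k) = qfrac p' d' (- k).
    by near: h.
  by apply: filterS2 h1 h2 => k -> ->.
rewrite (near_eq_derive _ e1).
have e2 : \forall k \near - h, derive1n n (qfrac p d) k = qfrac p' d' k by near: h.
rewrite (near_eq_derive _ e2).
have d'h : (map_poly (@ratr R) d').[expR (- h)] != 0 by near: h.
have D := is_derive_qfrac p' d'h.
have DN : is_derive h 1 (qfrac p' d' \o -%R)
   (qfrac ('X * (p'^`() * d' - p' * d'^`())) (d' ^+ 2) (- h) * - 1).
  by apply: is_derive1_comp.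
have DC := is_deriveM (is_derive_cst ((-1) ^+ n : R) h 1) DN.
rewrite [LHS](@derive_val _ _ _ _ _ _ _ DC) (@derive_val _ _ _ _ _ _ _ D).
by rewrite /GRing.scale /= mulr0 addr0 mulrN1 mulrN [(-1) ^+ n.+1]exprS mulN1r mulNr.
Unshelve. all: by end_near. Qed.

Section Coefficients.
Variable K : nat.

(* The expansion of p (exp h), modulo h^(K+1). *)
Definition qexp p : {poly rat} := p \Po texp K 1.

Lemma eqmodX_deriv n (a b : {poly rat}) : eqmodX n.+1 a b -> eqmodX n a^`() b^`().
Proof.
by move=> /eqmodXP e; apply/eqmodXP => k kn; rewrite !coef_deriv e.
Qed.

(** The formal counterpart of d/dh = q d/dq; the derivative of the truncated exponential loses its
    top coefficient. *)
Lemma qexp_deriv p : eqmodX K (qexp p)^`() (qexp ('X * p^`())).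
Proof.
rewrite /qexp deriv_comp comp_polyM comp_polyX mulrC; apply: eqmodXMr.
apply/eqmodXP => k kK; rewrite coef_deriv !coef_poly !ltnS kK (ltnW kK).
rewrite !expr1n !mul1r factS natrM invfM -mulrnAl -mulr_natr mulVf ?mul1r // pnatr_eq0.
Qed.

Lemma qexp_coef0 p : (qexp p)`_0 = p.[1].
Proof. by rewrite -horner_coef0 horner_comp horner_coef0 texp_coef0. Qed.

(** Identifies analytic Taylor coefficients with those of the formal quotient [f]. The quotient rule
    holds on both sides, and each derivative costs one order of precision. *)
Lemma derive1n_qfrac n (f : {poly rat}) p d : (n <= K)%N -> d.[1] != 0 ->
  eqmodX n.+1 (f * qexp d) (qexp p) ->
  derive1n n (qfrac p d) 0 = ratr (n`!%:R * f`_n).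
Proof.
elim: n f p d => [|n IH] f p d nK d1 e.
  rewrite /derive1n /qfrac /= expR0 -(rmorph1 (@ratr R)) !horner_map -fmorph_div /= fact0 mul1r.
  move/(eqmodX_coef0 (ltn0Sn _)): e; rewrite coef0M !qexp_coef0 => <-.
  by rewrite mulfK.
rewrite derive1Sn.
have := near_derive1n n (near_derive1_qfrac p d1).
move/nbhs_singleton => ->.
rewrite (IH f^`()) ?(ltnW nK) //.
- by rewrite coef_deriv factS natrM -mulr_natl; congr ratr; ring.
- by rewrite horner_exp expf_neq0.
have nK' : (n.+1 <= K)%N by [].
have ed := eqmodX_deriv e; rewrite derivM in ed.
have e' := eqmodX_le (leqnSn _) e.
have pd := eqmodX_le nK' (qexp_deriv p); have dd := eqmodX_le nK' (qexp_deriv d).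
(* With D the expansion of [d], the identity D (f D)' - (f D) D' = f' D^2 turns the congruence for
   [f] into the one for its derivative. *)
have h1 : eqmodX n.+1 (qexp d * (f^`() * qexp d + f * (qexp d)^`()))
                      (qexp d * qexp ('X * p^`())).
  by apply: eqmodXMl; apply: eqmodX_trans ed pd.
have h2 : eqmodX n.+1 ((f * qexp d) * (qexp d)^`()) (qexp p * qexp ('X * d^`())).
  exact: eqmodXM e' dd.
have := eqmodXB h1 h2.
have -> : qexp d * (f^`() * qexp d + f * (qexp d)^`()) - (f * qexp d) * (qexp d)^`() =
  f^`() * qexp (d ^+ 2) by rewrite /qexp rmorphXn /=; ring.
suff -> : qexp d * qexp ('X * p^`()) - qexp p * qexp ('X * d^`()) =
  qexp ('X * (p^`() * d - p * d^`())) by [].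
by rewrite /qexp !(comp_polyM, comp_polyB); ring.
Qed.
End Coefficients.

End TaylorExpansion.

Lemma cr_taylorE (R : realType) n (x : 4.-tuple (P1 rat)) (p d : {poly rat}) :
  crq x = tofrac p / tofrac d -> d.[1] != 0 ->
  cr_taylor R n x = derive1n n (@qfrac R p d) 0.
Proof.
move=> e d1; rewrite /cr_taylor e.
suff /near_derive1n h : \forall h \near (0 : R),
    reval (tofrac p / tofrac d) (expR h) = qfrac p d h.
  by rewrite (nbhs_singleton (h n)).
by apply: filterS (near0_qden R d1) => h /reval_frac.
Qed.

(** * Integral words produce expansions of q-rationals *)

Section IntegerWords.
Variables (F : numFieldType) (K : nat).
Hypothesis K0 : (0 < K)%N.
Implicit Types (a b : {poly rat}) (p r : {poly F}).

Let rat_texp : map_poly (@ratr F) (texp K 1) = texp K 1.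
Proof.
apply/polyP => k; rewrite coef_map !coef_poly; case: ifP => _; last exact: rmorph0.
by rewrite !expr1n !mul1r; exact: (etrans (fmorphV (@ratr F) _) (congr1 _ (rmorph_nat _ _))).
Qed.

Let J a : {poly F} := map_poly ratr (qexp K a).

Let JD a b : J (a + b) = J a + J b.
Proof. by rewrite /J /qexp comp_polyD rmorphD. Qed.

Let JN a : J (- a) = - J a.
Proof. by rewrite /J /qexp -[- a]sub0r comp_polyB comp_poly0 sub0r rmorphN. Qed.

Let JX a : J ('X * a) = texp K 1 * J a.
Proof. by rewrite /J /qexp comp_polyM comp_polyX rmorphM /= rat_texp. Qed.

(** The counterpart of [qorbit] for q-rationals: coordinates modulo h^K, up to a unit, of some [x]_q
    expanded at q = exp h. *)
Definition qrational p r := exists x a b (c : {poly F}),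
  [/\ c`_0 != 0, lifts x a b, eqmodX K p (c * J a) & eqmodX K r (c * J b)].

Lemma qrational_S p r : qrational p r -> qrational (- r) (texp K 1 * p).
Proof.
move=> [x [a [b [c [c0 /lifts_S h ep er]]]]].
exists (qneginv 1 x), (- b), ('X * a), c; split => //.
  by rewrite JN mulrN; apply: eqmodXN.
by rewrite JX mulrCA; apply: eqmodXMl.
Qed.

Lemma qrational_T1 p r : qrational p r ->
  qrational (texp K 1 * tquot K 1 * p + tquot K 1 * r) (tquot K 1 * r).
Proof.
move=> [x [a [b [c [c0 /lifts_T h ep er]]]]].
exists (qshift 1 x), ('X * a + b), b, (tquot K 1 * c); split => //.
- by rewrite coef0M mulf_neq0 ?tquot1_coef0.
- rewrite JD JX.
  have -> : tquot K 1 * c * (texp K 1 * J a + J b) =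
      texp K 1 * tquot K 1 * (c * J a) + tquot K 1 * (c * J b) by ring.
  by apply: eqmodXD; apply: eqmodXMl.
by rewrite -mulrA; apply: eqmodXMl.
Qed.

Lemma qrational_unscale (c : {poly F}) p r p' r' : c`_0 != 0 ->
  eqmodX K (c * p) p' -> eqmodX K (c * r) r' -> qrational p' r' -> qrational p r.
Proof.
move=> c0 ep er [x [a [b [d [d0 hx ep' er']]]]].
have [g hg] := eqmodX_div K 1 c0.
have g0 : g`_0 != 0.
  move/(eqmodX_coef0 K0): hg; rewrite coef0M coef1 /= => h.
  by apply: contra_eq_neq h => ->; rewrite mul0r eq_sym oner_neq0.
have cancel y y' u : eqmodX K (c * y) y' -> eqmodX K y' (d * u) -> eqmodX K y (g * d * u).
  move=> e e'; apply: (eqmodXI c0); apply: eqmodX_trans e _; apply: eqmodX_trans e' _.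
  have -> : c * (g * d * u) = g * c * (d * u) by ring.
  by rewrite -[X in eqmodX _ X _]mul1r; apply/eqmodXMr/eqmodX_sym.
exists x, a, b, (g * d); split => //; first by rewrite coef0M mulf_neq0.
  exact: cancel ep ep'.
exact: cancel er er'.
Qed.

Lemma qrational_T n p r : qrational p r ->
  qrational (texp K n%:R * tquot K 1 * p + tquot K n%:R * r) (tquot K 1 * r).
Proof.
move=> h; elim: n => [|n IH].
  have [x [a [b [c [c0 hx ep er]]]]] := h.
  exists x, a, b, (tquot K 1 * c); split => //.
  - by rewrite coef0M mulf_neq0 ?tquot1_coef0.
  - by rewrite texp0 tquot0 mul1r mul0r addr0 -mulrA; apply: eqmodXMl.
  by rewrite -mulrA; apply: eqmodXMl.
apply: (qrational_unscale (tquot1_coef0 F K0) _ _ (qrational_T1 IH)).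
  have -> : tquot K 1 * (texp K n.+1%:R * tquot K 1 * p + tquot K n.+1%:R * r) =
    tquot K 1 * (tquot K 1 * p) * texp K n.+1%:R + tquot K 1 * r * tquot K n.+1%:R by ring.
  rewrite -nat1r.
  have -> : texp K 1 * tquot K 1 * (texp K n%:R * tquot K 1 * p + tquot K n%:R * r) +
      tquot K 1 * (tquot K 1 * r) =
    tquot K 1 * (tquot K 1 * p) * (texp K 1 * texp K n%:R) +
    tquot K 1 * r * (texp K 1 * tquot K n%:R + tquot K 1) by ring.
  apply: eqmodXD; apply: eqmodXMl; apply: eqmodX_sym; last exact: tquotD.
  by apply: eqmodX_le (leqnSn K) _; apply: texpD.
exact: eqmodX_refl.
Qed.

Lemma qrational_qword (l : seq nat) :
  qrational (qword K (map (fun n => n%:R) l)).1 (qword K (map (fun n => n%:R) l)).2.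
Proof.
elim: l => [|n l IH] /=; last exact: qrational_T (qrational_S IH).
exists (Some 0), 0, 1, 1; rewrite coef1 oner_neq0; split => //; first exact: lifts_0.
  have -> : J 0 = 0 by rewrite /J /qexp comp_poly0 rmorph0.
  by rewrite mulr0; apply: eqmodX_refl.
have -> : J 1 = 1 by rewrite /J /qexp -(polyC1 rat) comp_polyC polyC1 rmorph1.
by rewrite mulr1; apply: eqmodX_refl.
Qed.

(** The nonzero constant term of [r] makes the point finite at q = 1. Its expansion then has
    rational coefficients [f], and any quotient computed over [F] is the image of [f]. *)
Lemma qrational_expansion p r : qrational p r -> r`_0 != 0 ->
  exists a b : {poly rat}, exists f : {poly rat}, [/\ b.[1] != 0,
    qrat (Some (a.[1] / b.[1])) = Some (tofrac a / tofrac b),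
    eqmodX K (f * qexp K b) (qexp K a) &
    forall g, eqmodX K (g * r) p -> eqmodX K g (map_poly ratr f)].
Proof.
move=> [x [a [b [c [c0 [_ ex e] ep er]]]]] r0.
have b1 : b.[1] != 0.
  apply: contraNneq r0 => b1; rewrite (eqmodX_coef0 K0 er) coef0M coef_map /=.
  by rewrite qexp_coef0 b1 rmorph0 mulr0.
have b0 : b != 0 by apply: contraNneq b1 => ->; rewrite horner0.
have qb0 : (qexp K b)`_0 != 0 by rewrite qexp_coef0.
have [f hf] := eqmodX_div K (qexp K a) qb0.
exists a, b, f; split => //.
  by move: e; rewrite -ex !point_col2 tofrac_eq0 (negPf b0) (negPf b1).
move=> g hg.
have Jb0 : (J b)`_0 != 0 by rewrite coef_map /= qexp_coef0 fmorph_eq0.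
apply: (eqmodXI (c := c * J b)); first by rewrite coef0M mulf_neq0.
have [u hu] := hf.
have Jf : eqmodX K (map_poly ratr f * J b) (J a).
  by exists (map_poly ratr u); rewrite -rmorphM hu rmorphD rmorphM /= map_polyXn.
rewrite mulrC; apply: (eqmodX_trans (b := g * r)); first exact/eqmodXMl/eqmodX_sym.
apply: eqmodX_trans hg _; apply: eqmodX_trans ep _.
by rewrite -mulrA [J b * _]mulrC; apply/eqmodXMl/eqmodX_sym.
Qed.

End IntegerWords.

Lemma cr_inf01 (L : fieldType) (y : L) : cr [tuple None; Some 0; Some 1; Some y] = y.
Proof.
rewrite /cr /crlift !det_cols !(tnth_nth None) /= !mxE /=.
by rewrite !(mulr0, mulr1, subr0, sub0r, mul1r) invrN invr1 mulrN1 opprK.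
Qed.

Lemma crq_inf01 (x : rat) (y : Qq) : qrat (Some x) = Some y ->
  crq [tuple None; Some 0; Some 1; Some x] = y.
Proof.
have [q0 qT qS] := qratP.
have qinf : qrat None = None by have := qS (Some 0); rewrite q0 /= eqxx.
have q1 : qrat (Some 1) = Some 1.
  by have := qT (Some 0); rewrite q0 /= !mulr0 !add0r.
move=> e; rewrite /crq -[RHS]cr_inf01; congr cr.
by apply: val_inj => /=; congr [:: _; _; _; _].
Qed.

(** * Invariance *)

Section Inversion.

Lemma crq_lifts (x : 4.-tuple (P1 rat)) (X : 'I_4 -> {poly rat} * {poly rat}) :
  uniq x -> (forall i, lifts (tnth x i) (X i).1 (X i).2) ->
  let D i j := (X i).1 * (X j).2 - (X j).1 * (X i).2 in
  crq x = tofrac (D 0 2 * D 1 3) / tofrac (D 0 3 * D 1 2) /\ (D 0 3 * D 1 2).[1] != 0.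
Proof.
move=> ux hX D; split.
  rewrite /crq (@cr_lift _ (fun i => col2 (tofrac (X i).1) (tofrac (X i).2))).
  - rewrite /crlift /= !det_cols !mxE /= !(tofracM, tofracB); ring.
  - by move=> i; have [n _ _] := hX i; apply: tofrac_col2_neq0.
  by move=> i; have [_ _ ->] := hX i; rewrite tnth_map.
have nD i j : i != j -> (D i j).[1] != 0.
  move=> ij; have [ni ei _] := hX i; have [nj ej _] := hX j.
  have := det_point_neq0 ni nj; rewrite ei ej det_cols !mxE /= /D !hornerE; apply.
  by apply: contra ij => /eqP h; apply/eqP/(tuple_uniqP _ ux).
by rewrite hornerM mulf_neq0 ?nD.
Qed.

Definition P1opp (x : P1 rat) : P1 rat := if x is Some a then Some (- a) else None.

(** Negation conjugates T into its inverse, expressed here without the inverse. *)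
Lemma P1opp_qshift x : qshift 1 (P1opp (qshift 1 x)) = P1opp x.
Proof. by case: x => [a|] //=; congr Some; rewrite !mul1r opprD subrK. Qed.

Lemma P1opp_qneginv x : P1opp (qneginv 1 x) = qneginv 1 (P1opp x).
Proof.
case: x => [a|] /=; last by rewrite oppr0.
by rewrite oppr_eq0; case: eqP => //= _; rewrite !mul1r invrN mulrN.
Qed.

Lemma P1opp_inj : injective P1opp.
Proof. by case=> [a|] [b|] //= [/oppr_inj ->]. Qed.

Variable R : realType.
Let ev (p : {poly rat}) (t : R) : R := (map_poly ratr p).[t].

Let evD p r t : ev (p + r) t = ev p t + ev r t.
Proof. by rewrite /ev rmorphD hornerD. Qed.

Let evN p t : ev (- p) t = - ev p t.
Proof. by rewrite /ev rmorphN hornerN. Qed.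

Let evM p r t : ev (p * r) t = ev p t * ev r t.
Proof. by rewrite /ev rmorphM hornerM. Qed.

Let evX t : ev 'X t = t.
Proof. by rewrite /ev map_polyX hornerX. Qed.

Let evE := (evD, evN, evM, evX).

(* [-x]_q = - q^-1 [x]_(q^-1), in homogeneous coordinates. *)
Lemma lifts_P1opp (x : P1 rat) :
  exists y : ({poly rat} * {poly rat}) * ({poly rat} * {poly rat}) * nat,
  let: ((a, b), (a', b'), m) := y in
  [/\ lifts x a b, lifts (P1opp x) a' b' &
      forall t, t != 0 -> ev a' t * t = - t ^+ m * ev a t^-1 /\ ev b' t = t ^+ m * ev b t^-1].
Proof.
move: x; apply: P1Q_ind.
- exists ((0, 1), (0, 1), 0%N); rewrite /= oppr0; split; try exact: lifts_0.
  by move=> t _; rewrite /ev rmorph0 rmorph1 !hornerC mulr0 mul0r mul1r.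
- move=> x [[[[a b] [a' b']] m] [h h' e]].
  exists (('X * a + b, b), (a' - b', 'X * b'), m.+1); split; first exact: lifts_T.
    by apply: lifts_TV; rewrite P1opp_qshift.
  move=> t t0; have [e1 e2] := e t t0; rewrite !evE mulrBl e1 e2 exprS; split; last by ring.
  by field.
- move=> x [[[[a b] [a' b']] m] [h h' e]].
  exists ((a - b, 'X * b), ('X * a' + b', b'), m.+1); split; first exact: lifts_TV.
    by rewrite -P1opp_qshift; apply: lifts_T.
  move=> t t0; have [e1 e2] := e t t0; rewrite !evE mulrDl [t * _]mulrC e1 e2 exprS.
  by split; field.
move=> x [[[[a b] [a' b']] m] [h h' e]].
exists ((- b, 'X * a), (b', - ('X * a')), m.+1); split; first exact: lifts_S.
  by rewrite P1opp_qneginv -[b']opprK; apply/lifts_opp/lifts_S.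
move=> t t0; have [e1 e2] := e t t0; rewrite !evE [t * _]mulrC e1 e2 exprS.
by split; field.
Qed.

(** By [lifts_P1opp], cr_q(-x) = cr_(1/q)(x), since the scalings of the lifts and the homography y
    |-> - y / q cancel; with q = exp h this replaces h by - h. *)
Lemma cr_taylor_opp n (x : 4.-tuple (P1 rat)) : uniq x ->
  cr_taylor R n [tuple of map P1opp x] = (-1) ^+ n * cr_taylor R n x.
Proof.
move=> ux.
have /choice [Y hY] := fun i => lifts_P1opp (tnth x i).
pose X i := (Y i).1.1; pose X' i := (Y i).1.2; pose m i := (Y i).2.
have hX i : lifts (tnth x i) (X i).1 (X i).2.
  by have := hY i; rewrite /X; case: (Y i) => [[[a b] [a' b']] k] [].
have hX' i : lifts (tnth [tuple of map P1opp x] i) (X' i).1 (X' i).2.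
  by have := hY i; rewrite /X' tnth_map; case: (Y i) => [[[a b] [a' b']] k] [].
have hm i t : t != 0 -> ev (X' i).1 t * t = - t ^+ m i * ev (X i).1 t^-1 /\
                        ev (X' i).2 t = t ^+ m i * ev (X i).2 t^-1.
  by have := hY i; rewrite /X /X' /m; case: (Y i) => [[[a b] [a' b']] k] [_ _]; apply.
have [|e' d'1] := crq_lifts _ hX'; first by rewrite map_inj_uniq //; apply: P1opp_inj.
have [e d1] := crq_lifts ux hX.
rewrite (cr_taylorE R n e' d'1) (cr_taylorE R n e d1).
set d := (X in _ * derive1n _ (qfrac _ X) _) in d1 *.
set p := (X in _ * derive1n _ (qfrac X _) _).
set d' := (X in derive1n _ (qfrac _ X) _ = _) in d'1 *.
set p' := (X in derive1n _ (qfrac X _) _ = _).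
suff -> : @qfrac R p' d' = fun h => qfrac p d (- h).
  by have := nbhs_singleton (derive1n_qfracN R n p d1); rewrite oppr0.
apply: funext => h; rewrite /qfrac expRN -!/(ev _ _).
set t := expR h; have t0 : t != 0 by rewrite expR_eq0.
(* Numerator and denominator each involve every point once, hence the same product of scalings; each
   of their two determinants also contributes - 1 / t. *)
pose M := t ^+ m 0 * t ^+ m 1 * t ^+ m 2 * t ^+ m 3.
have M0 : M / t ^+ 2 != 0 by rewrite !mulf_neq0 ?invr_eq0 ?expf_neq0.
have key i : ev (X' i).1 t = - t ^+ m i * ev (X i).1 t^-1 / t.
  by have [<- _] := hm i t t0; rewrite mulfK.
have key' i : ev (X' i).2 t = t ^+ m i * ev (X i).2 t^-1 by have [_ ->] := hm i t t0.
have -> : ev p' t = M / t ^+ 2 * ev p t^-1.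
  by rewrite /p' /p !evE !key !key' /M; field.
have -> : ev d' t = M / t ^+ 2 * ev d t^-1.
  by rewrite /d' /d !evE !key !key' /M; field.
by rewrite -mulf_div divff // mul1r.
Qed.

End Inversion.

(** * Homographies and the invariance of the cross-ratio *)

Section Homographies.
Variable K : fieldType.
Implicit Types (A B : 'M[K]_2) (x : P1 K).

Lemma mulmx_neq0 A (X : 'cV[K]_2) : A \in unitmx -> X != 0 -> A *m X != 0.
Proof.
by move=> uA; apply: contra => /eqP h; rewrite -[X](mulKmx uA) h mulmx0.
Qed.

Lemma P1_of_scale c (X : 'cV[K]_2) : c != 0 -> P1_of (c *: X) = P1_of X.
Proof.
move=> c0; rewrite /P1_of !mxE mulf_eq0 (negPf c0) /=; case: eqVneq => // X0.
by rewrite -mulf_div divff // mul1r.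
Qed.

Lemma moebiusM A B x : B \in unitmx -> moebius (A *m B) x = moebius A (moebius B x).
Proof.
move=> uB; rewrite /moebius -mulmxA.
have [c c0 {1}->] := lift_P1_of (mulmx_neq0 uB (lift_P1_neq0 x)).
by rewrite -scalemxAr P1_of_scale.
Qed.

Lemma moebius1 x : moebius 1%:M x = x.
Proof. by rewrite /moebius mul1mx lift_P1K. Qed.

Lemma moebius_inj A : A \in unitmx -> injective (moebius A).
Proof.
move=> uA; apply: (can_inj (g := moebius (invmx A))) => x.
by rewrite -moebiusM // mulVmx // moebius1.
Qed.

(** Every determinant is multiplied by [\det A], which cancels. *)
Lemma cr_moebius A (x : 4.-tuple (P1 K)) : A \in unitmx ->
  cr [tuple of map (moebius A) x] = cr x.
Proof.
move=> uA; rewrite (@cr_lift _ (fun i => A *m lift_P1 (tnth x i))).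
- rewrite /cr /crlift -!mul_mx_row !det_mulmx.
  have : \det A != 0 by rewrite -unitfE -unitmxE.
  move: (\det A) => a a0; rewrite ![a * _ * (a * _)]mulrACA -mulf_div.
  by rewrite divff ?mul1r // mulf_neq0.
- by move=> i; rewrite mulmx_neq0 // lift_P1_neq0.
by move=> i; rewrite tnth_map.
Qed.

End Homographies.

Section Mx2.
Variable S : comNzRingType.
Implicit Types (a b c d : S) (A B : 'M[S]_2).

Definition mx2 a b c d : 'M[S]_2 :=
  \matrix_(i < 2, j < 2) (if i == 0 then if j == 0 then a else b else if j == 0 then c else d).

Lemma mx2_eta A : A = mx2 (A 0 0) (A 0 1) (A 1 0) (A 1 1).
Proof.
apply/matrixP => -[[|[|//]] hi] [[|[|//]] hj]; rewrite !mxE /=;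
  by congr (A _ _); apply: val_inj.
Qed.

Lemma mulmx2 a b c d a' b' c' d' : mx2 a b c d *m mx2 a' b' c' d' =
  mx2 (a * a' + b * c') (a * b' + b * d') (c * a' + d * c') (c * b' + d * d').
Proof.
by apply/matrixP => -[[|[|//]] hi] [[|[|//]] hj]; rewrite !mxE !big_ord_recl big_ord0 !mxE /= addr0.
Qed.

Lemma mx2_1 : mx2 1 0 0 1 = 1%:M.
Proof. by apply/matrixP => -[[|[|//]] hi] [[|[|//]] hj]; rewrite !mxE. Qed.

End Mx2.

(** * Generation of GL(2, Z) by T, S and the negation N *)

Section GL2Z.

Definition GL2Z_T : 'M[int]_2 := mx2 1 1 0 1.
Definition GL2Z_S : 'M[int]_2 := mx2 0 (-1) 1 0.
Definition GL2Z_N : 'M[int]_2 := mx2 (-1) 0 0 1.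

Lemma unitmx_T : GL2Z_T \in unitmx.
Proof.
have e : GL2Z_T *m (mx2 1 (-1) 0 1) = 1%:M by rewrite mulmx2 -mx2_1; congr mx2.
by have [] := mulmx1_unit e.
Qed.

Lemma unitmx_S : GL2Z_S \in unitmx.
Proof.
have e : GL2Z_S *m (mx2 0 1 (-1) 0) = 1%:M by rewrite mulmx2 -mx2_1; congr mx2.
by have [] := mulmx1_unit e.
Qed.

Lemma intM_eq1 (u v : int) : u * v = 1 -> u = 1 \/ u = -1.
Proof.
move=> uv; have : u \is a GRing.unit by apply/unitrPr; exists v.
by rewrite unfold_in => /orP[/eqP|/eqP]; [left|right].
Qed.

(* Euclidean algorithm on the first column. *)
Lemma GL2Z_ind (P : 'M[int]_2 -> Prop) : P 1%:M ->
  (forall G, G \in [:: GL2Z_T; GL2Z_S; GL2Z_N] -> forall M, M \in unitmx ->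
     P M <-> P (G *m M)) ->
  forall M, M \in unitmx -> P M.
Proof.
move=> P1 PG.
have PT M : M \in unitmx -> P M <-> P (GL2Z_T *m M) by apply: PG; rewrite !inE eqxx.
have PS M : M \in unitmx -> P M <-> P (GL2Z_S *m M) by apply: PG; rewrite !inE eqxx !orbT.
have PN M : M \in unitmx -> P M <-> P (GL2Z_N *m M) by apply: PG; rewrite !inE eqxx !orbT.
have Tz a b c d (k : int) : mx2 a b c d \in unitmx ->
    mx2 (a + k * c) (b + k * d) c d \in unitmx /\
    (P (mx2 a b c d) <-> P (mx2 (a + k * c) (b + k * d) c d)).
  have TE u v : GL2Z_T *m mx2 u v c d = mx2 (u + c) (v + d) c d.
    by rewrite mulmx2 !mul1r !mul0r !add0r.
  move=> uM; elim: k => [|n [u IH]|n [u IH]]; first by rewrite !mul0r !addr0.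
    have e x y : x + n.+1%:Z * y = x + n%:Z * y + y by lia.
    by rewrite !e -TE unitmx_mul unitmx_T; split=> //; rewrite IH; apply: PT.
  set M' := mx2 _ _ _ _.
  have e x y : x + - n%:Z * y = x + - n.+1%:Z * y + y by lia.
  have E : GL2Z_T *m M' = mx2 (a + - n%:Z * c) (b + - n%:Z * d) c d by rewrite TE -!e.
  have uM' : M' \in unitmx by move: u; rewrite -E unitmx_mul => /andP[].
  split; first exact: uM'.
  have h := PT _ uM'; rewrite E in h; exact: iff_trans IH (iff_sym h).
have pS : P GL2Z_S by move/(PS _ (unitmx1 _ _)): P1; rewrite mulmx1.
suff main n a b c d : (`|c|%N < n)%N -> mx2 a b c d \in unitmx -> P (mx2 a b c d).
  by move=> M; rewrite [M]mx2_eta => uM; apply: (main _ _ _ _ _ (ltnSn _)).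
elim: n a b c d => // n IH a b c d cn uM.
have [c0|c0] := eqVneq c 0.
  subst c; have := mulmxV uM; have := mulVmx uM.
  rewrite [invmx _]mx2_eta !mulmx2 -mx2_1 => /matrixP /(_ 0 0) + /matrixP /(_ 1 1).
  rewrite !mxE /= !mulr0 !mul0r addr0 add0r [X in X = 1 -> _]mulrC => /intM_eq1 ea /intM_eq1 ed.
  (* Since d = 1 or -1, this power of T clears the entry [b]. The remaining diagonal matrices are 1,
     N, S^2 = -1 and N S^2. *)
  have [] := Tz _ _ _ _ (- (b * d)) uM.
  have -> : b + - (b * d) * d = 0 by case: ed => ->; ring.
  rewrite mulr0 addr0 => _ ->.
  have pm : P (mx2 (-1) 0 0 (-1)).
    by move/(PS _ unitmx_S): pS; rewrite mulmx2.
  have um : mx2 (-1) 0 0 (-1) \in @unitmx int 2.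
    by have := unitmx_mul GL2Z_S GL2Z_S; rewrite unitmx_S mulmx2.
  case: ea => ->; case: ed => -> //.
  - by rewrite mx2_1.
  - by move/(PN _ um): pm; rewrite mulmx2.
  by move/(PN _ (unitmx1 _ _)): P1; rewrite mulmx1.
have [uM' ->] := Tz _ _ _ _ (- (a %/ c)%Z) uM.
apply/(PS _ uM'); rewrite mulmx2; apply: IH; last first.
  by have := unitmx_mul GL2Z_S (mx2 (a + - (a %/ c)%Z * c) (b + - (a %/ c)%Z * d) c d);
    rewrite unitmx_S uM' mulmx2.
have -> : 1 * (a + - (a %/ c)%Z * c) + 0 * c = (a %% c)%Z by rewrite /modz; lia.
have := ltz_mod a c0; have := modz_ge0 a c0; lia.
Qed.

End GL2Z.

Lemma map_mx2 (f : {rmorphism int -> rat}) a b c d :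
  map_mx f (mx2 a b c d) = mx2 (f a) (f b) (f c) (f d).
Proof. by apply/matrixP => -[[|[|//]] hi] [[|[|//]] hj]; rewrite !mxE. Qed.

Section MoebiusGenerators.
Variables (L : fieldType) (q : L).

Lemma moebius_qshift : moebius (mx2 q 1 0 1) =1 qshift q.
Proof.
case=> [b|]; rewrite /moebius /P1_of !mxE !big_ord_recl !big_ord0 !mxE /=.
  by rewrite mul0r !mulr1 add0r addr0 oner_eq0 divr1.
by rewrite mul0r !mulr0 !addr0 eqxx.
Qed.

Lemma moebius_qneginv : q != 0 -> moebius (mx2 0 (-1) q 0) =1 qneginv q.
Proof.
move=> q0; case=> [b|]; rewrite /moebius /P1_of !mxE !big_ord_recl !big_ord0 !mxE /=.
  by rewrite !(mul0r, add0r, addr0, mulr1) mulf_eq0 (negPf q0).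
by rewrite !(mulr1, mulr0, addr0) (negPf q0) mul0r.
Qed.

Lemma unitmx_qshift : q != 0 -> mx2 q 1 0 1 \in unitmx.
Proof.
move=> q0; have e : mx2 q 1 0 1 *m mx2 q^-1 (- q^-1) 0 1 = 1%:M.
  by rewrite mulmx2 -mx2_1; congr mx2; field.
by have [] := mulmx1_unit e.
Qed.

Lemma unitmx_qneginv : q != 0 -> mx2 0 (-1) q 0 \in unitmx.
Proof.
move=> q0; have e : mx2 0 (-1) q 0 *m mx2 0 q^-1 (-1) 0 = 1%:M.
  by rewrite mulmx2 -mx2_1; congr mx2; field.
by have [] := mulmx1_unit e.
Qed.

End MoebiusGenerators.

Lemma moebius_P1opp : moebius (mx2 (-1) 0 0 1) =1 P1opp.
Proof.
case=> [b|]; rewrite /moebius /P1_of !mxE !big_ord_recl !big_ord0 !mxE /=.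
  by rewrite !(mul0r, mulr1, add0r, addr0) oner_eq0 mulN1r.
by [].
Qed.

(** Any map of P^1(Q) that becomes a homography over Q(q) on q-rationals preserves cr_q. *)
Lemma crq_map (f : P1 rat -> P1 rat) (A : 'M[Qq]_2) (x : 4.-tuple (P1 rat)) :
  A \in unitmx -> (forall y, qrat (f y) = moebius A (qrat y)) ->
  crq [tuple of map f x] = crq x.
Proof.
move=> uA hf; rewrite /crq -[RHS](cr_moebius _ uA); congr cr.
by apply: val_inj; rewrite /= -!map_comp; apply: eq_map => y /=.
Qed.

Section Invariance.
Variable R : realType.

Lemma unitmx_intr (M : 'M[int]_2) : M \in unitmx -> map_mx intr M \in @unitmx rat 2.
Proof. by rewrite !unitmxE det_map_mx => /(rmorph_unit (intr : int -> rat)). Qed.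

Lemma act_quad_uniq (M : 'M[int]_2) (x : 4.-tuple (P1 rat)) :
  M \in unitmx -> uniq x -> uniq (act_quad M x).
Proof.
by move=> uM; rewrite map_inj_uniq //; apply/moebius_inj/unitmx_intr.
Qed.

Lemma act_quadM (G M : 'M[int]_2) (x : 4.-tuple (P1 rat)) : M \in unitmx ->
  act_quad (G *m M) x = act_quad G (act_quad M x).
Proof.
move=> uM; apply: val_inj; rewrite /= -map_comp; apply: eq_map => y /=.
by rewrite map_mxM moebiusM ?unitmx_intr.
Qed.

Lemma act_quad_map (G : 'M[int]_2) (f : P1 rat -> P1 rat) (x : 4.-tuple (P1 rat)) :
  moebius (map_mx intr G) =1 f -> act_quad G x = [tuple of map f x].
Proof. by move=> e; apply: val_inj; apply: eq_map. Qed.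

Lemma cr_taylor_generator m G (x : 4.-tuple (P1 rat)) :
  G \in [:: GL2Z_T; GL2Z_S; GL2Z_N] -> uniq x ->
  cr_taylor R (2 * m) (act_quad G x) = cr_taylor R (2 * m) x.
Proof.
have [_ qT qS] := qratP; have v0 := qvar_neq0.
rewrite !inE => /or3P[] /eqP -> ux.
- rewrite (act_quad_map (f := qshift 1)) => [|y]; last by rewrite map_mx2 moebius_qshift.
  rewrite /cr_taylor (crq_map _ (unitmx_qshift v0)) // => y.
  by rewrite moebius_qshift qT.
- rewrite (act_quad_map (f := qneginv 1)) => [|y]; last first.
    by rewrite map_mx2 moebius_qneginv ?oner_neq0.
  rewrite /cr_taylor (crq_map _ (unitmx_qneginv v0)) // => y.
  by rewrite moebius_qneginv // qS.
rewrite (act_quad_map (f := P1opp)) => [|y]; last by rewrite map_mx2 moebius_P1opp.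
by rewrite cr_taylor_opp // exprM sqrrN expr1n expr1n mul1r.
Qed.

Lemma cr_taylor_invariant m (M : 'M[int]_2) (x : 4.-tuple (P1 rat)) :
  M \in unitmx -> uniq x -> cr_taylor R (2 * m) (act_quad M x) = cr_taylor R (2 * m) x.
Proof.
move=> uM ux; move: M uM; apply: GL2Z_ind.
  by congr cr_taylor; apply: val_inj; rewrite /= map_mx1 -[RHS]map_id;
    apply: eq_map => y; rewrite moebius1.
move=> G hG M uM; rewrite (act_quadM G x uM).
rewrite (cr_taylor_generator m hG (act_quad_uniq uM ux)); exact: iff_refl.
Qed.

End Invariance.

(** * Algebraic independence *)

Section Independence.
Variable R : realType.

Lemma ratr_complex (x : rat) : (ratr x : R)%:C%C = ratr x :> R[i].
Proof.
exact: (fmorph_eq_rat (@real_complex R \o @ratr R)).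
Qed.

Lemma cr_taylor_inf01 K n (a b f : {poly rat}) : (n < K)%N -> b.[1] != 0 ->
  qrat (Some (a.[1] / b.[1])) = Some (tofrac a / tofrac b) ->
  eqmodX K (f * qexp K b) (qexp K a) ->
  cr_taylor R n [tuple None; Some 0; Some 1; Some (a.[1] / b.[1])] = ratr (n`!%:R * f`_n).
Proof.
move=> nK b1 /crq_inf01 e ef; rewrite (cr_taylorE R n e b1).
by apply: (@derive1n_qfrac R K n f a b) => //; [exact: ltnW | exact: eqmodX_le ef].
Qed.

Lemma alg_independent_cr_taylor : alg_independent quads
    (fun (m : nat) (x : 4.-tuple (P1 rat)) => (cr_taylor R (2 * m) x)%:C%C : R[i]).
Proof.
case=> [|N] [P [/eqP P0 hP]]; apply: P0.
  (* For N = 0 the polynomial is a constant, and one admissible quadruple suffices. *)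
  have q2 : quads [tuple None; Some 0; Some 1; Some 2%:R] by [].
  by apply: mpoly_fun_eq0 => t; rewrite -(hP _ q2); apply: meval_eq => -[].
pose X0 : mpoly N.+1 R[i] := mpolyX _ (mnm1 ord0).
(* The quadruple (inf, 0, 1, x) is only allowed for x != 0, 1. *)
suff : P * (X0 * (X0 - 1)) = 0.
  have nz c t : t != c -> X0 - mpolyC _ c != 0.
    move=> tc; apply: contraNneq tc => h; rewrite -subr_eq0.
    have := congr1 (meval (fun=> t)) h.
    by rewrite mevalB mevalXU mevalC meval0 => ->.
  have X0nz : X0 != 0 by rewrite -[X0]subr0 -(mpolyC0 _ R[i]) (nz _ 1) ?oner_neq0.
  have X1nz : X0 - 1 != 0.
    by rewrite -(mpolyC1 _ R[i]) (nz _ 0) // eq_sym oner_neq0.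
  by move/eqP; rewrite !mulf_eq0 (negPf X0nz) (negPf X1nz) !orbF => /eqP.
(* The truncation must see the even orders up to 2 N, and [algebraic_density] asks for [3 <= K]. *)
pose K := (2 * N.+1 + 3)%N.
have K3 : (3 <= K)%N by rewrite leq_addl.
have NK : (2 * N.+1 <= K)%N by rewrite leq_addr.
have K0 : (0 < K)%N by apply: leq_trans K3.
apply: (algebraic_density K3 NK) => l r0 g hg.
have := qrational_qword R[i] K0 l.
move: (qword K _).1 (qword K _).2 r0 hg => p r r0 hg qr.
have [a [b [f [b1 e ef /(_ g hg) /eqmodXP gf]]]] := qrational_expansion K0 qr r0.
pose x0 := a.[1] / b.[1].
have dE (i : 'I_N.+1) : even_derivatives g i = ratr ((2 * i)`!%:R * f`_(2 * i)).
  rewrite /even_derivatives gf; last by apply: leq_trans NK; rewrite ltn_pmul2l.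
  by rewrite coef_map rmorphM /= rmorph_nat.
have d0 : even_derivatives g (ord0 : 'I_N.+1) = ratr x0.
  rewrite dE muln0 fact0 mul1r; congr ratr; apply: (canRL (mulfK b1)).
  by have := eqmodX_coef0 K0 ef; rewrite coef0M !qexp_coef0.
rewrite !mevalM mevalB mevalXU meval1 d0.
have [->|x00] := eqVneq x0 0; first by rewrite rmorph0 mul0r mulr0.
have [->|x01] := eqVneq x0 1; first by rewrite rmorph1 subrr !mulr0.
have qx : quads [tuple None; Some 0; Some 1; Some x0].
  by rewrite /quads /= !inE !(inj_eq (@Some_inj _)) !negb_or ![_ == x0]eq_sym x00 x01.
rewrite (@meval_eq _ _ _ (fun i : 'I_N.+1 =>
    (cr_taylor R (2 * i) [tuple None; Some 0; Some 1; Some x0])%:C%C)).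
  by rewrite (hP _ qx) mul0r.
move=> i; rewrite dE -ratr_complex -(cr_taylor_inf01 _ b1 e ef) //.
by apply: leq_trans NK; rewrite ltn_pmul2l.
Qed.
End Independence.

Theorem corollary1p4 (R : realType) :
  (forall (m : nat) (M : 'M[int]_2) (x : 4.-tuple (P1 rat)),
     M \in unitmx -> quads x ->
     cr_taylor R (2 * m) (act_quad M x) = cr_taylor R (2 * m) x)
  /\
  alg_independent quads
    (fun (m : nat) (x : 4.-tuple (P1 rat)) =>
       (cr_taylor R (2 * m) x)%:C%C : R[i]).
Proof.
split; last exact: alg_independent_cr_taylor.
by move=> m M x uM ux; apply: cr_taylor_invariant.
Qed.
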